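(* Given $L\in\mathcal{L}$, let $A_1,\ldots,A_m$ be non-negative matrices that define operators on $L$. If $\lambda>\rho(A_1\cdots A_m)$, then $$\rho((\lambda I-A_1\circ\cdots\circ A_m)^{-1})\le\rho((\lambda I-A_1\cdots A_m)^{-1}).$$
   Context: Let $R$ be either $\{1,\ldots,n\}$ for some $n\in\mathbb{N}$ or $\mathbb{N}$, and let $S(R)$ be the vector lattice of all complex sequences $(x_i)_{i\in R}$. A Banach space $L\subseteq S(R)$ is a Banach sequence space if $x\in S(R)$, $y\in L$ and $|x|\le|y|$ (coordinatewise) imply $x\in L$ and $\|x\|_L\le\|y\|_L$. $\mathcal{L}$ is the collection of all Banach sequence spaces $L$ such that $e_i=\chi_{\{i\}}\in L$ and $\|e_i\|_L=1$ for all $i\in R$. A matrix $A=[a_{ij}]_{i,j\in R}$ (possibly infinite) is non-negative if $a_{ij}\ge0$ for all $i,j\in R$. A non-negative matrix $A$ defines an operator on $L$ if $Ax\in L$ for all $x\in L$, where $(Ax)_i=\sum_{j\in R}a_{ij}x_j$; this operator is automatically bounded, and $A$ is identified with it. $\rho(A)$ is the spectral radius; $I$ is the identity operator; juxtaposition is the ordinary matrix product, and $A\circ B=[a_{ij}b_{ij}]_{i,j\in R}$ is the Hadamard product (which, for $L\in\mathcal{L}$, again defines an operator on $L$). $\lambda$ is a real number. *)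

(* Defs.v *)
From HB Require Import structures.
From mathcomp Require Import all_boot all_order all_algebra complex.
From mathcomp Require Import all_classical all_reals all_analysis.

Set Implicit Arguments.
Unset Strict Implicit.
Unset Printing Implicit Defensive.

Import Order.TTheory GRing.Theory Num.Theory.
Import numFieldNormedType.Exports.

Local Open Scope classical_set_scope.
Local Open Scope ring_scope.
Local Open Scope complex_scope.

(* [Segment n] stands for {1, ..., n+1}, so every segment is non-empty. *)
Variant index_set := Segment of nat | Naturals.

Definition seq_index (r : index_set) : choiceType :=
  match r with
  | Segment n => 'I_n.+1
  | Naturals => nat
  end.

Definition has_sum (K : numFieldType) (V : normedModType K) (r : index_set) :
    (seq_index r -> V) -> V -> Prop :=
  match r with
  | Segment n => fun f s => s = \sum_(j < n.+1) f j
  | Naturals => fun f s => series f @ \oo --> s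
  end.

(* Equal to 0 if the series diverges. *)
Definition sum_of (K : numFieldType) (V : normedModType K) (r : index_set)
    (f : seq_index r -> V) : V :=
  xget 0 [set s | has_sum f s].

(* The inclusion of L in S(R) is rendered by the injective linear map [seq_of].
   The norm of a normed module over [R[i]] takes its (real) values in [R[i]],
   where [<=] only compares numbers with the same imaginary part. *)
Record banachSeqSpace (R : realType) (r : index_set) := BanachSeqSpace {
  bseq_carrier :> completeNormedModType R[i];
  seq_of : {linear bseq_carrier -> (seq_index r -> R[i]^o)};
  seq_of_inj : injective seq_of;
  seq_of_ideal : forall (x : seq_index r -> R[i]^o) (y : bseq_carrier),
    (forall i, `|x i| <= `|seq_of y i|) ->
    exists2 z : bseq_carrier, seq_of z = x & `|z| <= `|y|
}.

Arguments seq_of {R r} _.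

(* The class of spaces containing every e_i, with norm 1. *)
Definition unit_vectors_normalized (R : realType) (r : index_set)
    (L : banachSeqSpace R r) : Prop :=
  forall i : seq_index r,
    exists2 e : L, seq_of L e = (fun j => (j == i)%:R) & `|e| = 1.

Section Matrices.
Variables (R : realType) (r : index_set).
Implicit Types A B : seq_index r -> seq_index r -> R.

Definition idmat : seq_index r -> seq_index r -> R := fun i j => (i == j)%:R.

Definition mulmat A B : seq_index r -> seq_index r -> R :=
  fun i j => sum_of (fun k => A i k * B k j).

(* A_0 (A_1 (... (A_(m-1) I))). *)
Definition prodmat (m : nat) (A : 'I_m -> seq_index r -> seq_index r -> R) :
    seq_index r -> seq_index r -> R :=
  \big[mulmat/idmat]_(k < m) A k.

Definition hadamard (m : nat) (A : 'I_m -> seq_index r -> seq_index r -> R) :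
    seq_index r -> seq_index r -> R :=
  fun i j => \prod_(k < m) A k i j.

Variable L : banachSeqSpace R r.

Definition is_image A (x y : L) : Prop :=
  forall i : seq_index r,
    has_sum (fun j => (A i j)%:C * seq_of L x j : R[i]^o) (seq_of L y i).

Definition defines_operator A : Prop := forall x : L, exists y : L, is_image A x y.

(* Meaningful when [defines_operator A]: the image is then unique. *)
Definition mxop A : L -> L := fun x => xget 0 [set y | is_image A x y].

End Matrices.

Arguments mxop {R r} L A x.

Section Operators.
Variables (R : realType) (X : completeNormedModType R[i]).
Implicit Types S T : X -> X.

Definition bounded_operator T : Prop := linear T /\ continuous T.

Definition is_inverse T S : Prop :=
  [/\ bounded_operator S, cancel T S & cancel S T].

Definition invertible_op T : Prop := exists S, is_inverse T S.

(* The zero map if [T] is not invertible. *)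
Definition op_inverse T : X -> X := xget (fun=> 0) [set S | is_inverse T S].

Definition scalar_minus (mu : R[i]) T : X -> X := fun x => mu *: x - T x.

Definition spectrum T : set R[i] := [set mu | ~ invertible_op (scalar_minus mu T)].

(* [sup] is 0 on empty or unbounded sets; the spectrum of a bounded operator on
   a nonzero complex Banach space is neither. *)
Definition spectral_radius T : R :=
  sup [set ComplexField.Normc.normc mu | mu in spectrum T].

End Operators.

(* Main.v *)
(* For a nonnegative operator [T] the resolvent [(t - T)^-1] is nonnegative for every
   real [t] beyond the spectral radius [rho T]: it is so for large [t], and the Neumann
   expansion of [(t - T)^-1] around a point extends positivity to the left as long as the
   resolvent exists.  Hence [rho T] belongs to the spectrum, and iterating
   [T (t - T)^-1 <= t (t - T)^-1] gives [|T ^ n| <= C t ^ n]; this replaces the Gelfand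
   formula, so that no complex analysis is needed.

   Let [P = A_1 ... A_m], let [H] be the Hadamard product and [P_d] the product of the
   factors in cyclic order starting from [A_d].  Expanding over paths, [H ^ (m n)] is
   entrywise at most the Hadamard product of the [P_d ^ n], and entries are bounded by
   operator norms because the unit vectors are normalized.  As [P_d ^ n] is a power of [P]
   up to bounded factors, [|H ^ (m n)| <= C s ^ (m n)] for all [s > rho P], whence
   [rho H <= rho P].  Finally
   [rho ((la - H)^-1) <= 1 / (la - rho P) <= rho ((la - P)^-1)],
   the second inequality because [rho P] is in the spectrum of [P]. *)
Require Import Defs.
From HB Require Import structures.
From mathcomp Require Import all_boot all_order all_algebra complex.
From mathcomp Require Import all_classical all_reals all_analysis.
From mathcomp Require Import ring lra zify.

Set Implicit Arguments.
Unset Strict Implicit.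
Unset Printing Implicit Defensive.

Import Order.TTheory GRing.Theory Num.Theory.
Import numFieldNormedType.Exports.

Local Open Scope classical_set_scope.
Local Open Scope ring_scope.
Local Open Scope complex_scope.

(** * Real-valued norms and geometric convergence *)

Local Notation normc := ComplexField.Normc.normc.

Lemma normr_normc (R : realType) (c : R[i]) : `|c| = (normc c)%:C.
Proof. by case: c. Qed.

Lemma normcC (R : realType) (a : R) : normc a%:C = `|a|.
Proof. by rewrite /= expr0n addr0 sqrtr_sqr. Qed.

Lemma normc_ge0 (R : realType) (c : R[i]) : 0 <= normc c.
Proof. by case: c => a b; exact: sqrtr_ge0. Qed.

Lemma normcV (R : realType) (c : R[i]) : normc c^-1 = (normc c)^-1.
Proof. exact: ComplexField.Normc.normcV. Qed.

Lemma normcX (R : realType) (c : R[i]) n : normc (c ^+ n) = normc c ^+ n.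
Proof.
elim: n => [|n IHn]; first by rewrite !expr0 ComplexField.Normc.normc1.
by rewrite !exprS ComplexField.Normc.normcM IHn.
Qed.

Section RealNorm.
Variables (R : realType) (X : normedModType R[i]).
Implicit Types (x y : X) (c : R[i]).

(** Real form of the norm, which itself takes values in [R[i]]; estimates can then use the linear
    order of [R]. *)
Definition rnorm x : R := complex.Re `|x|.

Lemma rnormE x : `|x| = (rnorm x)%:C.
Proof. by rewrite RRe_real // ger0_real. Qed.

Lemma rnorm_ge0 x : 0 <= rnorm x.
Proof. by rewrite -ler0c -rnormE. Qed.

Lemma rnormD x y : rnorm (x + y) <= rnorm x + rnorm y.
Proof. by rewrite -lecR rmorphD /= -!rnormE; exact: ler_normD. Qed.

Lemma rnormZ c x : rnorm (c *: x) = normc c * rnorm x.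
Proof. by apply: complexI; rewrite rmorphM /= -!rnormE normrZ normr_normc. Qed.

Lemma rnormN x : rnorm (- x) = rnorm x.
Proof. by rewrite /rnorm normrN. Qed.

Lemma rnormB x y : rnorm (x - y) <= rnorm x + rnorm y.
Proof. by rewrite -(rnormN y); exact: rnormD. Qed.

Lemma rnormBC x y : rnorm (x - y) = rnorm (y - x).
Proof. by rewrite -rnormN opprB. Qed.

Lemma rnorm0 : rnorm 0 = 0.
Proof. by rewrite /rnorm normr0. Qed.

Lemma rnorm_le0 x : rnorm x <= 0 -> x = 0.
Proof.
move=> x0; apply/eqP; rewrite -normr_eq0 rnormE.
by rewrite (le_anti (_ : rnorm x <= 0 <= rnorm x)) ?x0 ?rnorm_ge0.
Qed.

End RealNorm.

(** Serves to pass to the limit: an equality or an upper bound is proved by estimating its defect by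
    a geometric error at every stage. *)
Lemma le_geometric_le0 (R : realType) (a K q : R) : 0 <= q < 1 ->
  (forall n, a <= K * q ^+ n) -> a <= 0.
Proof.
move=> /andP[q0 q1] aK.
have /(cvgZl_tmp) : (fun n => q ^+ n) @ \oo --> (0 : R).
  by apply: cvg_expr; rewrite ger0_norm.
move=> /(_ K); rewrite scaler0 => /cvg_lim <- //.
apply: limr_ge; last by near=> n; exact: aK.
apply/cvg_ex; exists (K *: 0); apply: cvgZl_tmp.
by apply: cvg_expr; rewrite ger0_norm.
Unshelve. all: by end_near. Qed.

Lemma complete_geometric (R : realType) (X : completeNormedModType R[i])
    (u : nat -> X) (C q : R) : 0 <= q < 1 ->
  (forall n, rnorm (u n.+1 - u n) <= C * q ^+ n) ->
  exists l, forall n, rnorm (l - u n) <= C / (1 - q) * q ^+ n.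
Proof.
move=> /andP[q0 q1] uC.
have q1' : 0 < 1 - q by rewrite subr_gt0.
have C0 : 0 <= C.
  by have := le_trans (rnorm_ge0 _) (uC 0%N); rewrite expr0 mulr1.
set D := C / (1 - q).
have D0 : 0 <= D by rewrite divr_ge0 // ltW.
have uD n k : rnorm (u (n + k)%N - u n) <= D * q ^+ n.
  (* The factor [1 - q ^+ k] makes the induction close: [C = D * (1 - q)], so each new term
     telescopes. *)
  suff : rnorm (u (n + k)%N - u n) <= D * q ^+ n * (1 - q ^+ k).
    move=> /le_trans; apply; apply: ler_piMr.
      by rewrite mulr_ge0 ?exprn_ge0.
    by rewrite lerBlDr lerDl exprn_ge0.
  elim: k => [|k IHk]; first by rewrite addn0 !subrr rnorm0 mulr0.
  rewrite -(subrKA (u (n + k)%N)) addnS.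
  apply: le_trans (rnormD _ _) _; apply: le_trans (lerD (uC _) IHk) _.
  rewrite -[C](divfK (lt0r_neq0 q1')) -/D exprD exprS.
  by rewrite le_eqVlt; apply/orP; left; apply/eqP; ring.
have uE e : 0 < e -> exists N, D * q ^+ N < e.
  move=> e0; apply: contrapT => /forallNP De.
  suff : e <= 0 by rewrite leNgt e0.
  by apply: (@le_geometric_le0 _ _ D q); [rewrite q0|move=> n; rewrite leNgt; apply/negP/De].
have /cvg_ex[l ul] : cvg (u @ \oo).
  apply: cauchy_cvg; apply: cauchy_exP => e e0.
  have e0' : 0 < complex.Re e by move: e0; rewrite ltcE => /andP[].
  have [N DN] := uE _ e0'.
  exists (u N); exists N => // n /= Nn.
  rewrite -ball_normE /= -(RRe_real (gtr0_real e0)) rnormE ltcR rnormBC.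
  by rewrite -(subnKC Nn); exact: le_lt_trans (uD _ _) DN.
exists l => n; apply/ler_addgt0Pr => e e0.
have /(cvgrPdist_lt _ _).1 /(_ e%:C) := ul.
rewrite ltcR => /(_ e0)[N _ /(_ (N + n)%N)] /(_ (leq_addr _ _)) /=.
rewrite rnormE ltcR => /ltW le1.
rewrite -(subrKA (u (N + n)%N)) [leRHS]addrC; apply: le_trans (rnormD _ _) _.
by rewrite lerD // addnC uD.
Qed.

(** * Bounded operators and the Neumann series *)

Section Operators.
Variables (R : realType) (X : completeNormedModType R[i]).
Implicit Types (S T : X -> X) (x y : X).

Definition opbound T (M : R) : Prop := forall x, rnorm (T x) <= M * rnorm x.

Definition to_linear T (Tl : linear T) : {linear X -> X} :=
  HB.pack T (GRing.isLinear.Build _ _ _ _ T Tl).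

Lemma linear_0 T : linear T -> T 0 = 0.
Proof. by move=> Tl; rewrite -[T]/(to_linear Tl : X -> X) linear0. Qed.

Lemma linear_D T : linear T -> {morph T : x y / x + y}.
Proof. by move=> Tl x y; rewrite -[T]/(to_linear Tl : X -> X) linearD. Qed.

Lemma linear_B T : linear T -> {morph T : x y / x - y}.
Proof. by move=> Tl x y; rewrite -[T]/(to_linear Tl : X -> X) linearB. Qed.

Lemma linear_Z T a : linear T -> {morph T : x / a *: x}.
Proof. by move=> Tl x; rewrite -[T]/(to_linear Tl : X -> X) linearZ. Qed.

Lemma linear_comp S T : linear S -> linear T -> linear (S \o T).
Proof. by move=> Sl Tl a x y /=; rewrite Tl Sl. Qed.

Lemma linear_iter T n : linear T -> linear (iter n T).
Proof. by move=> Tl; elim: n => [|n IHn] a x y //=; rewrite IHn Tl. Qed.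

Lemma scalar_minus_linear mu T : linear T -> linear (scalar_minus mu T).
Proof.
move=> Tl a x y; rewrite /scalar_minus Tl scalerDr scalerBr opprD addrACA.
by rewrite !scalerA mulrC.
Qed.

Lemma opbound_comp S T (M N : R) : 0 <= M ->
  opbound S M -> opbound T N -> opbound (S \o T) (M * N).
Proof.
move=> M0 SM TN x; apply: le_trans (SM _) _.
by rewrite -mulrA ler_wpM2l.
Qed.

Lemma opbound_iter T (M : R) n : 0 <= M -> opbound T M ->
  opbound (iter n T) (M ^+ n).
Proof.
move=> M0 TM; elim: n => [|n IHn] x; first by rewrite expr0 mul1r.
by rewrite exprS; exact: opbound_comp IHn x.
Qed.

Lemma opbound_le T (M N : R) : opbound T M -> M <= N -> opbound T N.
Proof. by move=> TM MN x; rewrite (le_trans (TM x)) // ler_wpM2r ?rnorm_ge0. Qed.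

Lemma opbound_bounded T (M : R) : linear T -> opbound T M -> bounded_operator T.
Proof.
move=> Tl TM; split=> //.
have : continuous (to_linear Tl); last by [].
apply: bounded_linear_continuous; apply/linear_boundedP.
exists M%:C; split; first by rewrite complex_real.
move=> r Mr x; rewrite !rnormE.
have r0 : complex.Im r = 0 by move: Mr; rewrite ltcE => /andP[/eqP].
move: Mr; rewrite [r]complexE r0 mulr0 addr0 ltcR => Mr.
rewrite -rmorphM /= lecR; apply: le_trans (TM x) _.
by rewrite ler_wpM2r ?rnorm_ge0 // ltW.
Qed.

Lemma bounded_opbound T : bounded_operator T -> exists2 M, 0 < M & opbound T M.
Proof.
case=> Tl Tc; have : continuous (to_linear Tl) by [].
move=> /linear_bounded_continuous/linear_boundedP/pinfty_ex_gt0[r r0 Tr].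
have r0' : 0 < complex.Re r by move: r0; rewrite ltcE => /andP[].
exists (complex.Re r) => // x; rewrite -lecR rmorphM /=.
by rewrite (RRe_real (gtr0_real r0)) -!rnormE; exact: Tr.
Qed.

Lemma inverse_unique T S S' : is_inverse T S -> is_inverse T S' -> S = S'.
Proof.
move=> [_ TS ST] [_ TS' ST']; apply/funext => x.
by rewrite -{1}[x]ST' TS.
Qed.

Lemma op_inverseE T S : is_inverse T S -> op_inverse T = S.
Proof.
move=> TS; apply: (@inverse_unique T) => //.
by apply: xgetI; exact: TS.
Qed.

(** The inverse is a choice of solutions: injectivity makes it linear, the estimate makes it
    bounded. *)
Lemma inverse_of_solvable T (M : R) : linear T -> (forall x, T x = 0 -> x = 0) ->
  (forall y, exists2 x, T x = y & rnorm x <= M * rnorm y) ->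
  exists S, is_inverse T S.
Proof.
move=> Tl T0 TM.
have [S TS SM] : exists2 S, (cancel S T) & opbound S M.
  have /choice[S SP] : forall y, exists x, T x = y /\ rnorm x <= M * rnorm y.
    by move=> y; have [x] := TM y; exists x.
  by exists S => y; case: (SP y).
have Tinj x y : T x = T y -> x = y.
  by move=> Txy; apply/subr0_eq/T0; rewrite (linear_B Tl) Txy subrr.
exists S; split=> //; last by move=> x; apply: Tinj; rewrite TS.
apply: opbound_bounded SM => a x y.
by apply: Tinj; rewrite Tl !TS.
Qed.

Definition closed_cone (K : set X) : Prop :=
  [/\ K 0, forall x y, K x -> K y -> K (x + y),
      forall (a : R) x, 0 <= a -> K x -> K (a%:C *: x)
    & forall x, (forall e, 0 < e -> exists2 y, K y & rnorm (x - y) < e) -> K x].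

Definition preserves (K : set X) T : Prop := forall x, K x -> K (T x).

Lemma preserves_iter K T n : preserves K T -> preserves K (iter n T).
Proof. by move=> TK x Kx; elim: n => //= n; exact: TK. Qed.

(** It is the growth of the powers of [T] that is compared with [mu], so the series can be used down
    to the spectral radius. For real [mu > 0] its partial sums are positive combinations of
    iterates, which gives the statement on cones. *)
Lemma neumann T (M C s : R) (mu : R[i]) : linear T -> opbound T M ->
  0 <= s -> s < normc mu -> (forall n, opbound (iter n T) (C * s ^+ n)) ->
  exists2 S, is_inverse (scalar_minus mu T) S
    & forall K a, closed_cone K -> preserves K T -> 0 < a -> mu = a%:C ->
      preserves K S.
Proof.
move=> Tl TM s0 smu TC.
have mu0 : 0 < normc mu := le_lt_trans s0 smu.
have muN0 : mu != 0.
  by apply: contraTneq mu0 => ->; rewrite ComplexField.Normc.normc0 ltxx.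
set q := s / normc mu.
have q01 : 0 <= q < 1.
  by rewrite /q divr_ge0 ?normc_ge0 //= ltr_pdivrMr // mul1r.
have q1 : 0 < 1 - q by case/andP: q01 => _; rewrite subr_gt0.
pose u x n := \sum_(k < n) mu^-1 ^+ k.+1 *: iter k T x.
have uS x n : u x n.+1 - u x n = mu^-1 ^+ n.+1 *: iter n T x.
  by rewrite /u big_ord_recr /= addrAC subrr add0r.
have ruS x n : rnorm (mu^-1 ^+ n.+1 *: iter n T x)
    <= C * rnorm x / normc mu * q ^+ n.
  rewrite rnormZ normcX normcV.
  apply: le_trans (ler_wpM2l _ (TC n x)) _.
    by rewrite exprn_ge0 // invr_ge0 normc_ge0.
  rewrite le_eqVlt; apply/orP; left; apply/eqP.
  by rewrite /q expr_div_n exprS exprVn; field; rewrite expf_neq0 lt0r_neq0.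
have [S uSl] : exists S, forall x n,
    rnorm (S x - u x n) <= C * rnorm x / normc mu / (1 - q) * q ^+ n.
  have /choice[S SP] : forall x, exists l, forall n,
      rnorm (l - u x n) <= C * rnorm x / normc mu / (1 - q) * q ^+ n.
    move=> x; apply: complete_geometric => // n.
    by rewrite uS; exact: ruS.
  by exists S.
have Fu x n : scalar_minus mu T (u x n) = x - mu^-1 ^+ n *: iter n T x.
  elim: n => [|n IHn].
    by rewrite /u big_ord0 /scalar_minus (linear_0 Tl) scaler0 subrr expr0 scale1r subrr.
  have -> : u x n.+1 = u x n + mu^-1 ^+ n.+1 *: iter n T x.
    by rewrite -uS addrC subrK.
  rewrite (linear_D (scalar_minus_linear mu Tl)) IHn.
  rewrite (linear_Z _ (scalar_minus_linear mu Tl)) /scalar_minus scalerBr scalerA.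
  by rewrite exprSr mulfVK // -addrA addKr.
have FS x : scalar_minus mu T (S x) = x.
  apply/eqP; rewrite -subr_eq0; apply/eqP/rnorm_le0.
  apply: (@le_geometric_le0 _ _
    ((normc mu + M) * (C * rnorm x / normc mu / (1 - q)) + C * rnorm x) q) => // n.
  have -> : scalar_minus mu T (S x) - x =
      scalar_minus mu T (S x - u x n) - mu^-1 ^+ n *: iter n T x.
    rewrite (linear_B (scalar_minus_linear mu Tl)) Fu.
    by move: (scalar_minus _ _ _) => y; rewrite opprB addrA addrAC addrK.
  apply: le_trans (rnormB _ _) _; rewrite [leRHS]mulrDl; apply: lerD.
    apply: le_trans (rnormB _ _) _; rewrite rnormZ.
    rewrite -[leRHS]mulrA [leRHS]mulrDl; apply: lerD; first by rewrite ler_wpM2l ?normc_ge0.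
    (* A negative [M] is possible only if every norm vanishes. *)
    have M0 : 0 <= M \/ forall y : X, rnorm y = 0.
      have [M0|M0] := leP 0 M; [by left|right=> y].
      apply/le_anti; rewrite rnorm_ge0 andbT.
      have := le_trans (rnorm_ge0 _) (TM y).
      by rewrite nmulr_rge0.
    case: M0 => [M0|X0]; last by rewrite !X0 !(mulr0, mul0r).
    by apply: le_trans (TM _) _; rewrite ler_wpM2l.
  rewrite rnormZ normcX normcV; apply: le_trans (ler_wpM2l _ (TC n x)) _.
    by rewrite exprn_ge0 // invr_ge0 normc_ge0.
  rewrite le_eqVlt; apply/orP; left; apply/eqP.
  by rewrite /q expr_div_n exprVn; ring.
(* An eigenvector for [mu] satisfies [T ^ n x = mu ^ n x], which outgrows [s ^ n] unless [x = 0]. *)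
have F0 x : scalar_minus mu T x = 0 -> x = 0.
  move=> /subr0_eq muT; apply: rnorm_le0.
  apply: (@le_geometric_le0 _ _ (C * rnorm x) q) => // n.
  have Tn : iter n T x = mu ^+ n *: x.
    elim: n => [|n IHn]; first by rewrite expr0 scale1r.
    by rewrite iterS IHn (linear_Z _ Tl) -muT scalerA exprSr.
  have := TC n x; rewrite Tn rnormZ normcX => le1.
  rewrite /q expr_div_n mulrA ler_pdivlMr ?exprn_gt0 //.
  by rewrite [leLHS]mulrC [leRHS]mulrAC.
have [S' S'P] : exists S', is_inverse (scalar_minus mu T) S'.
  apply: (@inverse_of_solvable _ (C / normc mu / (1 - q))) => //.
    exact: scalar_minus_linear.
  move=> y; exists (S y) => //.
  (* The case [n = 0] of the convergence rate is the norm bound for the inverse. *)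
  have := uSl y 0%N; rewrite /u big_ord0 subr0 expr0 mulr1 => /le_trans; apply.
  by rewrite le_eqVlt; apply/orP; left; apply/eqP; ring.
exists S' => // K a [K0 KD KZ Kcl] TK a0 mua x Kx.
have -> : S' x = S x by case: S'P => _ FK _; rewrite -[in LHS](FS x) FK.
apply: Kcl => e e0.
have [n un] : exists n, rnorm (S x - u x n) < e.
  apply: contrapT => /forallNP ge_e.
  suff : e <= 0 by rewrite leNgt e0.
  apply: (@le_geometric_le0 _ _ (C * rnorm x / normc mu / (1 - q)) q) => // n.
  by apply: le_trans (uSl x n); rewrite leNgt; apply/negP.
exists (u x n) => //; rewrite /u; elim/big_ind: _ => // k _.
rewrite mua -fmorphV -rmorphXn; apply: KZ; last exact: preserves_iter.
by rewrite exprn_ge0 // invr_ge0 ltW.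
Qed.

End Operators.

(** * Positive operators with respect to a closed cone *)

Section Spectrum.
Variables (R : realType) (X : completeNormedModType R[i]).
Implicit Types (S T : X -> X) (x y : X) (K : set X).

(** By [t - eps - T = (1 - eps S) (t - T)], the new inverse is [S] composed with the Neumann inverse
    of [1 - eps S]. For real [eps >= 0], that is when moving to the left, [eps S] is positive and
    positivity survives. *)
Lemma inverse_perturb T (t eps : R[i]) S (M : R) :
  is_inverse (scalar_minus t T) S -> 0 <= M -> opbound S M ->
  normc eps * M < 1 ->
  exists2 S', is_inverse (scalar_minus (t - eps) T) S'
    & forall K a, closed_cone K -> preserves K S -> 0 <= a -> eps = a%:C ->
      preserves K S'.
Proof.
move=> [[Sl Sc] TS ST] M0 SM epsM.
pose E x := eps *: S x.
have El : linear E.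
  by move=> a x y; rewrite /E Sl scalerDr !scalerA mulrC.
have EM : opbound E (normc eps * M).
  by move=> x; rewrite /E rnormZ -mulrA ler_wpM2l ?normc_ge0.
have e0 : 0 <= normc eps * M by rewrite mulr_ge0 ?normc_ge0.
have En n : opbound (iter n E) (1 * (normc eps * M) ^+ n).
  by rewrite mul1r; exact: opbound_iter.
have norm1 : normc (1 : R[i]) = 1 := ComplexField.Normc.normc1 R.
have := @neumann _ _ E _ 1 _ 1 El EM e0 _ En.
rewrite norm1 => /(_ epsM)[V [[Vl Vc] EV VE] VK].
exists (S \o V).
  split=> /=.
  - have [MV MV0 VM] := bounded_opbound (conj Vl Vc).
    apply: (@opbound_bounded _ _ _ (M * MV)); first exact: linear_comp.
    exact: opbound_comp.
  - move=> x /=; have -> : scalar_minus (t - eps) T x =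
        scalar_minus 1 E (scalar_minus t T x).
      by rewrite [RHS]/scalar_minus /E TS scale1r /scalar_minus scalerBl addrAC.
    by rewrite EV TS.
  - move=> x /=; have -> : scalar_minus (t - eps) T (S (V x)) =
        scalar_minus t T (S (V x)) - eps *: S (V x).
      by rewrite /scalar_minus scalerBl addrAC.
    by rewrite ST -[RHS]VE /scalar_minus scale1r.
move=> K a Kcl SK a0 epsa x Kx /=; apply: (SK).
apply: (VK K 1) => //; move=> y Ky; rewrite /E epsa.
by case: Kcl => _ _ KZ _; apply: KZ => //; exact: SK.
Qed.

Lemma not_spectrum T mu : ~ spectrum T mu -> invertible_op (scalar_minus mu T).
Proof. exact: contrapT. Qed.

Lemma spectrum_powers T (M C s : R) mu : linear T -> opbound T M -> 0 <= s ->
  (forall n, opbound (iter n T) (C * s ^+ n)) -> spectrum T mu -> normc mu <= s.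
Proof.
move=> Tl TM s0 Tn Tmu; rewrite leNgt; apply/negP => smu; apply: Tmu.
by have [S S_inv _] := neumann Tl TM s0 smu Tn; exists S.
Qed.

Lemma spectrum_le T (M : R) mu : linear T -> 0 <= M -> opbound T M ->
  spectrum T mu -> normc mu <= M.
Proof.
move=> Tl M0 TM; apply: (spectrum_powers (C := 1) Tl TM M0) => n.
by rewrite mul1r; exact: opbound_iter.
Qed.

Lemma le_spectral_radius T mu : bounded_operator T -> spectrum T mu ->
  normc mu <= spectral_radius T.
Proof.
move=> Tb Tmu; have [M /ltW M0 TM] := bounded_opbound Tb.
apply: ub_le_sup; last by exists mu.
by exists M => _ [nu Tnu <-]; case: Tb => Tl _; exact: spectrum_le Tnu.
Qed.

Lemma spectral_radius_le T (b : R) : 0 <= b ->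
  (forall mu, spectrum T mu -> normc mu <= b) -> spectral_radius T <= b.
Proof.
move=> b0 Tb; rewrite /spectral_radius.
(* For an empty spectrum [sup] is 0, and the claim is [0 <= b]. *)
set A := (X in sup X); have [->|/set0P A0] := eqVneq A set0; first by rewrite sup0.
by apply: ge_sup => // _ [mu Tmu <-]; exact: Tb.
Qed.

Lemma spectral_radius_ge0 T : 0 <= spectral_radius T.
Proof.
rewrite /spectral_radius; set A := (X in sup X).
have [supA|/sup_out ->] := pselect (has_sup A); last by [].
have [[x Ax] _] := supA; have [mu _ mux] := Ax.
apply: le_trans (ub_le_sup _ Ax); last by case: supA.
by rewrite -mux normc_ge0.
Qed.

Definition pos_resolvent K T (s : R) : Prop :=
  exists2 S, is_inverse (scalar_minus s%:C T) S & preserves K S.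

(** Positivity is given only to the right of [s0], so the expansion starts at [s0 + d]. The
    resolvent identity bounds the resolvent there by twice its bound at [s0], so that the expansion
    reaches down to [s0 - d]. *)
Lemma pos_resolvent_left K T (s0 : R) : closed_cone K ->
  invertible_op (scalar_minus s0%:C T) ->
  (forall t, s0 < t -> pos_resolvent K T t) ->
  exists2 d, 0 < d & forall s, s0 - d < s <= s0 -> pos_resolvent K T s.
Proof.
move=> Kcl [S0 S0_inv] Kt.
have [S0b TS0 S0T] := S0_inv; have [M M0 S0M] := bounded_opbound S0b.
(* As [d * M = 1/4], the bound [2 * M] holds at [s0 + d], and every shift below [2 * d] is
   admissible for [inverse_perturb]. *)
pose d := (4 * M)^-1.
have d0 : 0 < d by rewrite invr_gt0 mulr_gt0.
have dM : d * M = 4^-1 by rewrite /d; field; exact: lt0r_neq0.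
have t0 : s0 < s0 + d by rewrite ltrDl.
have [S S_inv SK] := Kt _ t0; have [[Sl Sc] TS ST] := S_inv.
have SM : opbound S (2 * M).
  move=> x; set z := S x.
  have xz : S0 x = z + d%:C *: S0 z.
    rewrite -[in LHS](ST x) -/z /scalar_minus rmorphD /= scalerDl.
    case: S0b => S0l _; rewrite addrAC (linear_D S0l) (linear_Z _ S0l).
    by have := TS0 z; rewrite /scalar_minus => ->.
  have zE : z = S0 x - d%:C *: S0 z by rewrite xz addrK.
  have : rnorm z <= M * rnorm x + 4^-1 * rnorm z.
    rewrite {1}zE; apply: le_trans (rnormB _ _) _; apply: lerD; first exact: S0M.
    by rewrite rnormZ normcC gtr0_norm // -dM -mulrA ler_wpM2l // ltW.
  by have := rnorm_ge0 x; nra.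
exists d => // s /andP[ds ss0].
have [] := @inverse_perturb T (s0 + d)%:C (s0 + d - s)%:C S (2 * M) S_inv _ SM.
- by rewrite mulr_ge0 // ltW.
- have se : 0 <= s0 + d - s by lra.
  by rewrite normcC ger0_norm //; have := M0; nra.
rewrite -rmorphB /= subKr => S' S'_inv S'K; exists S' => //.
by apply: (S'K K (s0 + d - s)) => //; lra.
Qed.

(** Abstracts the cone of nonnegative sequences. The four pieces correspond to the positive and
    negative parts of the real and imaginary parts. *)
Definition banach_cone K : Prop :=
  [/\ closed_cone K,
      forall x y, K x -> K (y - x) -> rnorm x <= rnorm y
    & forall x, exists u : 'I_4 -> X,
      (forall k, K (u k) /\ rnorm (u k) <= rnorm x) /\
      x = \sum_(k < 4) 'i ^+ k *: u k].

Section Positive.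
Variables (K : set X) (Kb : banach_cone K).

Let Kcl : closed_cone K. Proof. by case: Kb. Qed.

(** The factor 4 counts the pieces of the decomposition. *)
Lemma cone_opbound T (M : R) : linear T ->
  (forall x, K x -> rnorm (T x) <= M * rnorm x) -> 0 <= M -> opbound T (4 * M).
Proof.
move=> Tl TM M0 x; case: Kb => _ _ /(_ x)[u [uK xE]].
have normi : normc ('i : R[i]) = 1 by rewrite /= expr0n expr1n add0r sqrtr1.
have Tu (k : 'I_4) : rnorm ('i ^+ k *: T (u k)) <= M * rnorm x.
  rewrite rnormZ normcX normi expr1n mul1r.
  have [Kuk ukx] := uK k.
  by apply: le_trans (TM _ Kuk) _; rewrite ler_wpM2l.
have -> : T x = \sum_(k < 4) 'i ^+ k *: T (u k).
  rewrite xE; rewrite -[T]/(to_linear Tl : X -> X) linear_sum.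
  by apply: eq_bigr => k _; rewrite linearZ.
rewrite !big_ord_recl big_ord0 addr0.
have -> : 4 * M * rnorm x =
  M * rnorm x + (M * rnorm x + (M * rnorm x + M * rnorm x)) by ring.
do 3![apply: le_trans (rnormD _ _) _; apply: lerD; first exact: Tu].
exact: Tu.
Qed.

(* Otherwise there are [v n] in the cone with [|v n| <= 2 ^- n] and [|T (v n)| >= 2 ^ n];
   their sum [l] dominates each [v n], so that [|T l| >= 2 ^ n] for all [n]. *)
Lemma cone_bounded T : linear T -> preserves K T -> bounded_operator T.
Proof.
move=> Tl TK.
suff [M M0 TM] : exists2 M, 0 <= M & forall x, K x -> rnorm (T x) <= M * rnorm x.
  by apply: opbound_bounded => //; exact: cone_opbound TM M0.
apply: contrapT => noM.
have [K0 KD KZ Klim] := Kcl; have [_ Kmono _] := Kb.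
have /choice[v vP] (n : nat) : exists v : X,
    [/\ K v, rnorm v <= 2^-1 ^+ n & 2 ^+ n <= rnorm (T v)].
  have [w Kw Tw] : exists2 w, K w & 4 ^+ n * rnorm w < rnorm (T w).
    apply: contrapT => now; apply: noM; exists (4 ^+ n) => [|x Kx].
      by rewrite exprn_ge0.
    by rewrite leNgt; apply/negP => lt1; apply: now; exists x.
  have w0 : 0 < rnorm w.
    rewrite lt_neqAle rnorm_ge0 andbT; apply/negP => /eqP w0.
    have : w = 0 by apply: rnorm_le0; rewrite -w0.
    by move=> wE; move: Tw; rewrite wE (linear_0 Tl) !rnorm0 mulr0 ltxx.
  pose a := 2^-1 ^+ n / rnorm w.
  have a0 : 0 <= a by rewrite divr_ge0 ?rnorm_ge0 ?exprn_ge0 ?invr_ge0.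
  exists (a%:C *: w); split; first exact: KZ.
    by rewrite rnormZ normcC ger0_norm // /a divfK ?lt0r_neq0.
  rewrite (linear_Z _ Tl) rnormZ normcC ger0_norm //.
  apply: le_trans (ler_wpM2l a0 (ltW Tw)).
  rewrite /a mulrCA divfK ?lt0r_neq0 // mulrC -exprMn.
  by rewrite (_ : 2^-1 * 4 = 2) //; field.
pose u n := \sum_(k < n) v k.
have uS n : u n.+1 - u n = v n by rewrite /u big_ord_recr /= addrAC subrr add0r.
have h1 : 0 <= (2^-1 : R) < 1 by rewrite invr_ge0 ler0n invf_lt1 ?ltr1n.
have [] := @complete_geometric _ _ u 1 (2^-1) h1.
  by move=> n; rewrite uS mul1r; case: (vP n).
move=> l lu.
have Ku n k : K (u (n + k)%N - u n).
  elim: k => [|k IHk]; first by rewrite addn0 subrr.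
  rewrite addnS -(subrKA (u (n + k)%N)) uS; apply: KD => //.
  by case: (vP (n + k)%N).
have Klu n : K (l - u n).
  apply: Klim => e e0.
  have [k uk] : exists k, rnorm (l - u (n + k)%N) < e.
    apply: contrapT => /forallNP ge_e.
    suff : e <= 0 by rewrite leNgt e0.
    apply: (@le_geometric_le0 _ _ (1 / (1 - 2^-1) * 2^-1 ^+ n) (2^-1)) => // k.
    apply: le_trans (_ : rnorm (l - u (n + k)%N) <= _).
      by rewrite leNgt; apply/negP.
    by have := lu (n + k)%N; rewrite exprD mulrA.
  by exists (u (n + k)%N - u n) => //; rewrite opprB subrKA.
have Kv n : K (l - v n).
  have -> : l - v n = (l - u n.+1) + u n by rewrite -uS opprB addrA addrAC.
  apply: KD => //; by have := Ku 0%N n; rewrite add0n /u big_ord0 subr0.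
have [n] : exists n, rnorm (T l) < 2 ^+ n.
  apply: contrapT => /forallNP ge2.
  suff : (1 : R) <= 0 by rewrite ler10.
  apply: (@le_geometric_le0 _ _ (rnorm (T l)) (2^-1)) => // n.
  by rewrite exprVn ler_pdivlMr ?exprn_gt0 // mul1r leNgt; apply/negP; exact: ge2.
apply/negP; rewrite -leNgt; case: (vP n) => Kvn _ /le_trans; apply.
by apply: Kmono; [exact: TK|rewrite -(linear_B Tl); exact/TK/Kv].
Qed.

Lemma pos_resolvent_powers T (s : R) : linear T -> preserves K T -> 0 < s ->
  pos_resolvent K T s -> exists2 C, 0 <= C & forall n, opbound (iter n T) (C * s ^+ n).
Proof.
move=> Tl TK s0 [S [[Sl Sc] TS ST] SK].
have [M M0 SM] := bounded_opbound (conj Sl Sc).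
have [K0 KD KZ _] := Kcl; have [_ Kmono _] := Kb.
exists (4 * (s * M)) => [|n]; first by rewrite !mulr_ge0 // ltW.
rewrite -mulrA; apply: cone_opbound; first exact: linear_iter.
  move=> x Kx; have Kz : K (S x) by exact: SK.
  have xE : x = s%:C *: S x - T (S x) by rewrite -{1}[x]ST.
  (* In the order of the cone [T (S x) = s S x - x <= s S x], and this is iterated. *)
  have KTn k : K (s%:C ^+ k *: S x - iter k T (S x)).
    elim: k => [|k IHk]; first by rewrite expr0 scale1r subrr.
    have -> : s%:C ^+ k.+1 *: S x - iter k.+1 T (S x) =
        s%:C ^+ k *: x + T (s%:C ^+ k *: S x - iter k T (S x)).
      rewrite (linear_B Tl) (linear_Z _ Tl) {3}xE scalerBr scalerA exprSr.
      by rewrite addrA subrK.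
    by apply: KD; [rewrite -rmorphXn; apply: KZ; rewrite ?exprn_ge0 // ltW|exact: TK].
  have Kx' : K (s%:C *: S x - x) by rewrite {2}xE opprB addrC subrK; exact: TK.
  have lTn := linear_iter n Tl.
  (* Since [x <= s S x], also [T ^ n x <= s T ^ n (S x) <= s ^ (n + 1) S x]; monotonicity of the
     norm then gives the bound. *)
  have h : K (s%:C ^+ n.+1 *: S x - iter n T x).
    have -> : s%:C ^+ n.+1 *: S x - iter n T x =
        s%:C *: (s%:C ^+ n *: S x - iter n T (S x)) + iter n T (s%:C *: S x - x).
      rewrite (linear_B lTn) (linear_Z _ lTn) scalerBr scalerA exprS.
      by rewrite addrA subrK.
    by apply: KD; [apply: KZ => //; exact: ltW|exact: preserves_iter].
  apply: le_trans (Kmono _ _ (preserves_iter n TK Kx) h) _.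
  rewrite rnormZ normcX normcC gtr0_norm //.
  apply: le_trans (ler_wpM2l _ (SM x)) _; first by rewrite exprn_ge0 // ltW.
  by rewrite le_eqVlt; apply/orP; left; apply/eqP; rewrite exprS; ring.
by rewrite !mulr_ge0 ?exprn_ge0 // ltW.
Qed.

Lemma pos_resolvent_gt T (t : R) : linear T -> preserves K T ->
  spectral_radius T < t -> pos_resolvent K T t.
Proof.
move=> Tl TK rt.
have Tb : bounded_operator T by exact: cone_bounded.
have [M M0 TM] := bounded_opbound Tb.
have inv s : spectral_radius T < s -> invertible_op (scalar_minus s%:C T).
  move=> rs; apply: not_spectrum => /(le_spectral_radius Tb).
  by rewrite normcC leNgt (lt_le_trans rs) // ler_norm.
have Mpos s : M < s -> pos_resolvent K T s.
  move=> Ms; have s0 : 0 < s := lt_trans M0 Ms.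
  have [||S S_inv SK] := @neumann _ _ T M 1 M s%:C Tl TM (ltW M0).
  - by rewrite normcC gtr0_norm.
  - by move=> n; rewrite mul1r; apply: opbound_iter => //; exact: ltW.
  by exists S => //; exact: SK TK s0 _.
apply: contrapT => tN.
(* At [sup G], which lies beyond the spectral radius, the resolvent exists, and to the right it is
   positive; [pos_resolvent_left] then clears a left neighbourhood of the supremum of [G], a
   contradiction. *)
pose G := [set s | spectral_radius T < s /\ ~ pos_resolvent K T s].
have Gt : G t by [].
have GM : ubound G M.
  by move=> s [_ sN]; rewrite leNgt; apply/negP => /Mpos.
have hG : has_sup G by split; [exists t|exists M].
have tG : t <= sup G by apply: ub_le_sup => //; exists M.
have rG : spectral_radius T < sup G := lt_le_trans rt tG.
have [s Gs|d d0 dP] := pos_resolvent_left Kcl (inv _ rG).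
  apply: contrapT => sN; suff : s <= sup G by rewrite leNgt Gs.
  apply: ub_le_sup; first by exists M.
  by split=> //; exact: lt_trans Gs.
have [s Gs ds] := sup_adherent d0 hG.
case: (Gs) => _; apply; apply: dP; rewrite ds /=.
by apply: ub_le_sup => //; exists M.
Qed.

Lemma spectral_radius_powers T (s : R) : linear T -> preserves K T ->
  spectral_radius T < s -> exists2 C, 0 <= C & forall n, opbound (iter n T) (C * s ^+ n).
Proof.
move=> Tl TK rs; apply: pos_resolvent_powers => //; last exact: pos_resolvent_gt.
by apply: le_lt_trans rs; exact: spectral_radius_ge0.
Qed.

(** Otherwise the positive resolvent continues to some positive [s] below the spectral radius, and
    the resulting bound on the powers confines the spectrum to a smaller disc. *)
Lemma spectral_radius_spectrum T x : x != 0 -> linear T -> preserves K T ->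
  spectrum T (spectral_radius T)%:C.
Proof.
move=> x0 Tl TK inv.
have [M M0 TM] := bounded_opbound (cone_bounded Tl TK).
have [t|d d0 dP] := pos_resolvent_left Kcl inv; first exact: pos_resolvent_gt.
(* For spectral radius 0 no smaller positive [s] exists. There the resolvent at 0 is a positive
   inverse of [- T], so for [y] in the cone [- y = T (S y)] is in the cone too; the cone is then
   trivial, against [x != 0]. *)
have := spectral_radius_ge0 T; rewrite le_eqVlt => /orP[/eqP r0|r0].
  have [|S [_ _ ST] SK] := dP 0; first by rewrite -r0 lexx sub0r oppr_lt0 d0.
  have [K0 KD KZ _] := Kcl; have [_ Kmono Kgen] := Kb.
  have Kx y : K y -> y = 0.
    move=> Ky; apply: rnorm_le0; rewrite -(@rnorm0 _ X); apply: Kmono => //.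
    rewrite -(ST y) /scalar_minus rmorph0 scale0r !sub0r opprK.
    by apply: TK; exact: SK.
  have [u [uK xE]] := Kgen x; case/eqP: x0; rewrite xE big1 // => k _.
  by rewrite (Kx (u k)) ?scaler0 //; case: (uK k).
(* The first term keeps [s] positive, the second keeps it within [d] of the spectral radius. *)
pose s := Num.max (spectral_radius T / 2) (spectral_radius T - d / 2).
have s0 : 0 < s by rewrite /s lt_max divr_gt0.
have sr : s < spectral_radius T by rewrite /s gt_max; apply/andP; split; lra.
have [|C C0 TC] := pos_resolvent_powers Tl TK s0.
  by apply: dP; rewrite (ltW sr) andbT /s lt_max; apply/orP; right; lra.
suff : spectral_radius T <= s by rewrite leNgt sr.
apply: spectral_radius_le => [|mu]; first exact: ltW.
exact: spectrum_powers TM (ltW s0) TC.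
Qed.

End Positive.
End Spectrum.

(** * Sums over the index set *)

Section Sums.
Variable r : index_set.
Local Notation I := (seq_index r).

(* For a segment this is the whole index set, whatever [n]. *)
Definition initial (n : nat) : seq I :=
  match r return seq (seq_index r) with
  | Segment k => index_enum 'I_k.+1
  | Naturals => index_iota 0 n
  end.

Lemma initial_uniq n : uniq (initial n).
Proof. by rewrite /initial; case: r => [k|]; [exact: index_enum_uniq|exact: iota_uniq]. Qed.

Lemma mem_initial (i : I) : exists N, forall n, (N <= n)%N -> i \in initial n.
Proof.
rewrite /initial; case: r i => [k|] i; first by exists 0%N => n _; exact: mem_index_enum.
by exists i.+1 => n; rewrite mem_index_iota.
Qed.

(** Treats both kinds of index set at once: over a segment the partial sums are constant. *)
Lemma has_sumP (K : numFieldType) (V : normedModType K) (f : I -> V) (s : V) :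
  has_sum f s <-> (fun n => \sum_(j <- initial n) f j) @ \oo --> s.
Proof.
rewrite /has_sum /initial; case: r f => [k|] f; last by [].
split=> [->|]; first exact: cvg_cst.
move=> h; apply/esym; apply: (cvg_unique (@norm_hausdorff _ _) (cvg_cst _) h).
Qed.

Section Linear.
Variables (K : numFieldType) (V : normedModType K).
Implicit Types f g : I -> V.

Lemma has_sum_unique f s t : has_sum f s -> has_sum f t -> s = t.
Proof. by move=> /has_sumP fs /has_sumP; exact: (cvg_unique (@norm_hausdorff _ _) fs). Qed.

Lemma has_sum_lin a f g s t : has_sum f s -> has_sum g t ->
  has_sum (fun j : I => a *: f j + g j) (a *: s + t).
Proof.
move=> /has_sumP fs /has_sumP gt; apply/has_sumP.
rewrite (_ : (fun n => _) = (fun n => a *: (\sum_(j <- initial n) f j)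
  + \sum_(j <- initial n) g j)).
  by apply: cvgD => //; exact: cvgZl_tmp.
by apply/funext => n; rewrite big_split -scaler_sumr.
Qed.

Lemma has_sum0 : has_sum ((fun=> 0) : I -> V) 0.
Proof.
by apply/has_sumP; rewrite (_ : (fun n => _) = fun=> 0); [exact: cvg_cst|
  apply/funext => n; rewrite big1].
Qed.

Lemma has_sum_sum (J : Type) (l : seq J) (F : J -> I -> V) (s : J -> V) :
  (forall k, has_sum (F k) (s k)) ->
  has_sum (fun j : I => \sum_(k <- l) F k j) (\sum_(k <- l) s k).
Proof.
move=> Fs; elim: l => [|k l IHl].
  by rewrite big_nil; under [X in has_sum X]eq_fun do rewrite big_nil; exact: has_sum0.
rewrite big_cons; under [X in has_sum X]eq_fun do rewrite big_cons.
rewrite -[s k]scale1r; have := has_sum_lin 1 (Fs k) IHl.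
by under eq_fun do rewrite scale1r.
Qed.

Lemma has_sum_delta i (f : I -> V) : has_sum (fun j : I => (i == j)%:R *: f j) (f i).
Proof.
apply/has_sumP; have [N iN] := mem_initial i.
apply: cvg_near_cst; exists N => // n /= Nn.
rewrite (bigD1_seq i) ?initial_uniq ?iN //= eqxx scale1r big1 ?addr0 // => j ji.
by rewrite eq_sym (negbTE ji) scale0r.
Qed.

End Linear.

Lemma sum_ofE (R : realType) (f : I -> R) s : has_sum f s -> sum_of f = s.
Proof. by move=> fs; apply: (has_sum_unique _ fs); apply: xgetI; exact: fs. Qed.

Section Nonnegative.
Variable R : realType.
Implicit Types (f g : I -> R) (s t : R).

Lemma has_sumZ a f s : has_sum f s -> has_sum (fun j : I => a * f j) (a * s).
Proof.
move=> fs; have := has_sum_lin a fs (has_sum0 _).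
by rewrite addr0; under eq_fun do rewrite addr0.
Qed.

Lemma partial_sum_mono f : (forall j, 0 <= f j) ->
  nondecreasing_seq (fun n => \sum_(j <- initial n) f j).
Proof.
move=> f0; apply/nondecreasing_seqP => n.
rewrite /initial; case: r f f0 => [k|] f f0; first exact: lexx.
by rewrite big_nat_recr //= lerDl.
Qed.

Lemma has_sum_ge f s n : (forall j, 0 <= f j) -> has_sum f s ->
  \sum_(j <- initial n) f j <= s.
Proof.
move=> f0 /has_sumP fs; rewrite -(cvg_lim _ fs) //.
apply: nondecreasing_cvgn_le; first exact: partial_sum_mono.
by apply/cvg_ex; exists s.
Qed.

Lemma has_sum_ge0 f s : (forall j, 0 <= f j) -> has_sum f s -> 0 <= s.
Proof. by move=> f0 /(has_sum_ge 0 f0); apply: le_trans; exact: sumr_ge0. Qed.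

Lemma has_sum_ge1 f s i : (forall j, 0 <= f j) -> has_sum f s -> f i <= s.
Proof.
move=> f0 fs; have [n /(_ n (leqnn n)) ni] := mem_initial i.
apply: le_trans (has_sum_ge n f0 fs).
by rewrite (bigD1_seq i) ?initial_uniq //= lerDl sumr_ge0.
Qed.

Lemma has_sum_le f g s t : (forall j, f j <= g j) ->
  has_sum f s -> has_sum g t -> s <= t.
Proof.
move=> fg /has_sumP fs /has_sumP gt.
by apply: ler_cvg_to fs gt _; near=> n; exact: ler_sum.
Unshelve. all: by end_near. Qed.

Lemma has_sum_lub f s : (forall j, 0 <= f j) ->
  (forall n, \sum_(j <- initial n) f j <= s) ->
  (forall e, 0 < e -> exists n, s - e <= \sum_(j <- initial n) f j) ->
  has_sum f s.
Proof.
move=> f0 fs sf; apply/has_sumP/cvgrPdist_le => e e0.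
have [N sN] := sf _ e0; exists N => // n /= Nn.
rewrite ger0_norm ?subr_ge0 // lerBlDl -lerBlDr; apply: le_trans sN _.
exact: partial_sum_mono.
Qed.

Lemma has_sum_dominated f g t : (forall j, 0 <= f j <= g j) -> has_sum g t ->
  exists s, has_sum f s.
Proof.
move=> fg gt; have f0 j : 0 <= f j by case/andP: (fg j).
have g0 j : 0 <= g j by case/andP: (fg j) => ? /(le_trans _); apply.
have : cvgn (fun n => \sum_(j <- initial n) f j).
  apply: nondecreasing_is_cvgn; first exact: partial_sum_mono.
  exists t => _ [n _ <-]; apply: le_trans (has_sum_ge n g0 gt).
  by apply: ler_sum => j _; case/andP: (fg j).
by move=> /cvg_ex[s fs]; exists s; apply/has_sumP.
Qed.

Lemma has_sum_tonelli (f : I -> I -> R) g h s : (forall k j, 0 <= f k j) ->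
  (forall k, has_sum (f k) (g k)) -> has_sum g s ->
  (forall j, has_sum (f^~ j) (h j)) -> has_sum h s.
Proof.
move=> f0 fg gs fh.
have g0 k : 0 <= g k by exact: has_sum_ge0 (fg k).
have h0 j : 0 <= h j by exact: has_sum_ge0 (fh j).
apply: has_sum_lub => // [n|e e0].
  apply: has_sum_le (has_sum_sum (initial n) fh) gs => k.
  exact: has_sum_ge.
(* Finitely many rows [k] carry [s] up to [e / 2]; then finitely many columns [j] carry these rows
   up to another [e / 2]. *)
have e2 : 0 < e / 2 by rewrite divr_gt0.
have /has_sumP/cvgrPdist_lt/(_ _ e2)[N _ /(_ N (leqnn N)) /= gN] := gs.
have := has_sum_sum (initial N) fg => /has_sumP/cvgrPdist_lt/(_ _ e2).
move=> [n _ /(_ n (leqnn n)) /= fn]; exists n.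
have : \sum_(j <- initial n) \sum_(k <- initial N) f k j <= \sum_(j <- initial n) h j.
  by apply: ler_sum => j _; exact: has_sum_ge.
move: gN fn; rewrite !ltr_norml => /andP[_ ?] /andP[_ ?] ?; lra.
Qed.

(** A nonnegative term is at most the sum of its series: this bounds all factors but the first, and
    the first is then summed. *)
Lemma has_sum_prod (m : nat) (u : 'I_m.+1 -> I -> R) (U : 'I_m.+1 -> R) v :
  (forall c j, 0 <= u c j) -> (forall c, has_sum (u c) (U c)) ->
  has_sum (fun j : I => \prod_c u c j) v -> v <= \prod_c U c.
Proof.
move=> u0 uU uv; rewrite big_ord_recl mulrC.
apply: has_sum_le uv (has_sumZ _ (uU ord0)) => j.
rewrite big_ord_recl mulrC ler_wpM2r //.
by apply: ler_prod => c _; rewrite u0 /=; exact: has_sum_ge1.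
Qed.

Lemma has_sum_realP f s :
  has_sum (fun j : I => (f j)%:C : R[i]^o) (s%:C : R[i]^o) <-> has_sum f s.
Proof.
have sumC n : `|(s%:C : R[i]^o) - \sum_(j <- initial n) (f j)%:C|
    = `|s - \sum_(j <- initial n) f j|%:C.
  rewrite -normcC -normr_normc rmorphB rmorph_sum; reflexivity.
split=> /has_sumP/cvgrPdist_lt fs; apply/has_sumP/cvgrPdist_lt => e e0.
  have e0' : 0 < e%:C by rewrite ltcR.
  have [N _ fN] := fs _ e0'; exists N => // n /fN /=.
  by rewrite sumC ltcR.
have e0' : 0 < complex.Re e by move: e0; rewrite ltcE => /andP[].
have [N _ fN] := fs _ e0'; exists N => // n /fN /=.
by rewrite sumC -ltcR (RRe_real (gtr0_real e0)).
Qed.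

Lemma has_sum_real f (z : R[i]^o) : has_sum (fun j : I => (f j)%:C : R[i]^o) z ->
  z = (complex.Re z)%:C /\ has_sum f (complex.Re z).
Proof.
move=> fz; suff fRe : has_sum f (complex.Re z).
  by split=> //; apply: has_sum_unique fz _; apply/has_sum_realP.
move: fz => /has_sumP/cvgrPdist_lt fz; apply/has_sumP/cvgrPdist_lt => e e0.
have e0' : 0 < e%:C by rewrite ltcR.
have [N _ fN] := fz _ e0'; exists N => // n /fN /=.
rewrite -ltcR; apply: le_lt_trans; apply: le_trans (normc_ge_Re _).
have -> : \sum_(j <- initial n) (f j)%:C = (\sum_(j <- initial n) f j)%:C :> R[i].
  by rewrite rmorph_sum.
by rewrite lecR raddfB.
Qed.

End Nonnegative.
End Sums.

(** * Kernel operators on a sequence space *)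

Section SequenceSpace.
Variables (R : realType) (r : index_set) (L : banachSeqSpace R r).
Hypothesis L_unit : unit_vectors_normalized L.
Local Notation I := (seq_index r).
Implicit Types (x y : L) (i j k : I) (A B : I -> I -> R) (S T : L -> L).

Lemma seq_ofD x y i : seq_of L (x + y) i = seq_of L x i + seq_of L y i.
Proof. by rewrite linearD. Qed.

Lemma seq_ofZ a x i : seq_of L (a *: x) i = a * seq_of L x i.
Proof. by rewrite linearZ. Qed.

Lemma seq_ofB x y i : seq_of L (x - y) i = seq_of L x i - seq_of L y i.
Proof. by rewrite linearB. Qed.

Lemma seq_of0 i : seq_of L 0 i = 0.
Proof. by rewrite linear0. Qed.

Lemma seq_of_ext x y : (forall i, seq_of L x i = seq_of L y i) -> x = y.
Proof. by move=> xy; apply: (@seq_of_inj R r L); apply/funext. Qed.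

Lemma ideal_vector (f : I -> R[i]) y : (forall i, normc (f i) <= normc (seq_of L y i)) ->
  exists2 z : L, (forall i, seq_of L z i = f i) & rnorm z <= rnorm y.
Proof.
move=> fy; have [|z zf zy] := @seq_of_ideal R r L f y.
  by move=> i; rewrite !normr_normc lecR.
by exists z; [move=> i; rewrite zf|move: zy; rewrite !rnormE lecR].
Qed.

Lemma rnorm_le_coord x y :
  (forall i, normc (seq_of L x i) <= normc (seq_of L y i)) -> rnorm x <= rnorm y.
Proof.
move=> xy; have [z zx] := ideal_vector xy.
by rewrite (seq_of_ext zx).
Qed.

Lemma unit_vector_ex : exists e : I -> L,
  forall j, (forall i, seq_of L (e j) i = (i == j)%:R) /\ rnorm (e j) = 1.
Proof.
suff /choice[e eP] : forall j, exists e : L,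
  (forall i, seq_of L e i = (i == j)%:R) /\ rnorm e = 1 by exists e.
move=> j; have [e eE e1] := L_unit j; exists e; split; first by move=> i; rewrite eE.
by rewrite /rnorm e1.
Qed.

Definition unit_vector : I -> L := sval (cid unit_vector_ex).

Lemma unit_vectorE j i : seq_of L (unit_vector j) i = (i == j)%:R.
Proof. by rewrite /unit_vector; case: cid => e /= /(_ j)[]. Qed.

Lemma rnorm_unit_vector j : rnorm (unit_vector j) = 1.
Proof. by rewrite /unit_vector; case: cid => e /= /(_ j)[]. Qed.

(** The vector [x_i e_i] is dominated by [x], and [e_i] has norm 1. *)
Lemma coord_le_rnorm x i : normc (seq_of L x i) <= rnorm x.
Proof.
have -> : normc (seq_of L x i) = rnorm (seq_of L x i *: unit_vector i).
  by rewrite rnormZ rnorm_unit_vector mulr1.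
apply: rnorm_le_coord => j; rewrite seq_ofZ unit_vectorE.
have [->|_] := eqVneq j i; first by rewrite mulr1.
by rewrite mulr0 ComplexField.Normc.normc0 normc_ge0.
Qed.

(** In [R[i]] this inequality also forces the coordinates to be real. *)
Definition nonneg : set L := [set x | forall i, (0 : R[i]) <= seq_of L x i].

Definition re_coord x i : R := complex.Re (seq_of L x i).

Lemma re_coordE x i : nonneg x -> seq_of L x i = (re_coord x i)%:C.
Proof. by move=> x0; rewrite /re_coord RRe_real // ger0_real. Qed.

Lemma re_coord_ge0 x i : nonneg x -> 0 <= re_coord x i.
Proof. by move=> x0; rewrite -ler0c -re_coordE. Qed.

Lemma re_coordB x y i : re_coord (x - y) i = re_coord x i - re_coord y i.
Proof. by rewrite /re_coord seq_ofB raddfB. Qed.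

Lemma nonneg_unit_vector j : nonneg (unit_vector j).
Proof. by move=> i; rewrite unit_vectorE ler0n. Qed.

Lemma nonneg_closed_cone : closed_cone nonneg.
Proof.
split.
- by move=> i; rewrite seq_of0.
- by move=> x y x0 y0 i; rewrite seq_ofD addr_ge0.
- by move=> a x a0 x0 i; rewrite seq_ofZ mulr_ge0 // ler0c.
- move=> x xlim i; rewrite lecE /=.
  (* Evaluation at [i] is a contraction, so a vector within [e] of the cone has coordinates within
     [e] of the nonnegative reals. *)
  have near e : 0 < e -> `|complex.Im (seq_of L x i)| <= e /\
      - e <= complex.Re (seq_of L x i).
    move=> e0; have [y y0 xy] := xlim _ e0.
    have := le_lt_trans (coord_le_rnorm (x - y) i) xy.
    rewrite seq_ofB (re_coordE _ y0) => /ltW.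
    have := re_coord_ge0 i y0.
    case: (seq_of L x i) => a b /= c0; move: (re_coord y i) c0 => c c0.
    rewrite oppr0 addr0 => abe.
    have [ace be] : `|a - c| <= e /\ `|b| <= e.
      have e2 : (a - c) ^+ 2 + b ^+ 2 <= e ^+ 2.
        rewrite -(@sqr_sqrtr _ ((a - c) ^+ 2 + b ^+ 2)) ?addr_ge0 ?sqr_ge0 //.
        by rewrite lerXn2r // nnegrE ?sqrtr_ge0 // ltW.
      split; rewrite -(@ler_pXn2r _ 2) ?nnegrE ?normr_ge0 ?(ltW e0) //;
        rewrite real_normK ?num_real // (le_trans _ e2) //.
        by rewrite lerDl sqr_ge0.
      by rewrite lerDr sqr_ge0.
    split=> //; move: ace; rewrite ler_norml => /andP[]; lra.
  apply/andP; split.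
    rewrite -normr_eq0 eq_le normr_ge0 andbT.
    by apply/ler_addgt0Pr => e e0; rewrite add0r; case: (near _ e0).
  rewrite -subr_le0 sub0r; apply/ler_addgt0Pr => e e0.
  by rewrite add0r lerNl; case: (near _ e0).
Qed.

Lemma nonneg_banach_cone : banach_cone nonneg.
Proof.
split; first exact: nonneg_closed_cone.
  move=> x y x0 xy; apply: rnorm_le_coord => i.
  have y0 : nonneg y by move=> k; rewrite -(subrK x y) seq_ofD addr_ge0.
  rewrite !re_coordE // !normcC !ger0_norm ?re_coord_ge0 // -subr_ge0 -re_coordB.
  exact: re_coord_ge0.
move=> x.
(* The list follows the coefficients 1, i, -1, -i. Each part is dominated by [x], so the ideal
   property puts it in [L] with no larger norm. *)
pose f (k : 'I_4) (c : R[i]) : R :=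
  Num.max 0 (nth 0 [:: complex.Re c; complex.Im c; - complex.Re c; - complex.Im c] k).
have fc (k : 'I_4) (c : R[i]) : normc (f k c)%:C <= normc c.
  rewrite normcC ger0_norm ?le_max ?lexx // /f ge_max normc_ge0 /=.
  case: c => a b /=; have ha : `|a| <= Num.sqrt (a ^+ 2 + b ^+ 2).
    by rewrite -sqrtr_sqr ler_sqrt ?addr_ge0 ?sqr_ge0 // lerDl sqr_ge0.
  have hb : `|b| <= Num.sqrt (a ^+ 2 + b ^+ 2).
    by rewrite -sqrtr_sqr ler_sqrt ?addr_ge0 ?sqr_ge0 // lerDr sqr_ge0.
  move: ha hb; rewrite !ler_norml => /andP[? ?] /andP[? ?].
  by case: k => -[|[|[|[|]]]] //= _; lra.
have /choice[u uP] : forall k : 'I_4, exists z : L,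
    (forall i, seq_of L z i = (f k (seq_of L x i))%:C) /\ rnorm z <= rnorm x.
  move=> k; have [|z zf zx] := @ideal_vector (fun i => (f k (seq_of L x i))%:C) x.
    by move=> i; exact: fc.
  by exists z.
exists u; split.
  move=> k; have [uk ukx] := uP k; split=> // i.
  by rewrite uk ler0c /f le_max lexx.
apply: seq_of_ext => i.
have u_i (k : 'I_4) := (uP k).1 i.
rewrite !big_ord_recl big_ord0 addr0 !(seq_ofD, seq_ofZ) !u_i /f /=.
have maxN (a : R) : Num.max 0 a - Num.max 0 (- a) = a.
  by have [a0|a0] := leP 0 a; [rewrite max_l|rewrite max_r]; lra.
case: (seq_of L x i) => a b /=.
rewrite /bump /= !addn0 /= expr0 expr1 mul1r sqr_i exprS sqr_i mulN1r mulrN1.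
by apply/eqP; rewrite eq_complex /=; apply/andP; split; apply/eqP;
  rewrite -[LHS]maxN; ring.
Qed.

Lemma nonneg_ind (Q : L -> Prop) : (forall x, nonneg x -> Q x) ->
  (forall a x y, Q x -> Q y -> Q (a *: x + y)) -> forall x, Q x.
Proof.
move=> Q0 QD x; have [_ _ /(_ x)[u [u0 ->]]] := nonneg_banach_cone.
elim/big_rec: _ => [|k y _ Qy]; first by apply: Q0; case: nonneg_closed_cone.
by apply: QD => //; apply: Q0; case: (u0 k).
Qed.

Lemma is_image_unique A x y z : is_image A x y -> is_image A x z -> y = z.
Proof. by move=> xy xz; apply: seq_of_ext => i; exact: has_sum_unique (xy i) (xz i). Qed.

Lemma is_image_lin A a x x' y y' : is_image A x y -> is_image A x' y' ->
  is_image A (a *: x + x') (a *: y + y').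
Proof.
move=> xy xy' i; have := has_sum_lin a (xy i) (xy' i).
rewrite seq_ofD seq_ofZ; congr has_sum; apply/funext => j.
by rewrite seq_ofD seq_ofZ mulrDr; congr (_ + _); rewrite [LHS]mulrCA.
Qed.

Lemma is_image_nonnegP A x y : nonneg x -> nonneg y ->
  (is_image A x y <->
   forall i, has_sum (fun j => A i j * re_coord x j) (re_coord y i)).
Proof.
move=> x0 y0.
have fE i : (fun j => (A i j)%:C * seq_of L x j : R[i]^o) =
    (fun j => (A i j * re_coord x j)%:C : R[i]^o).
  by apply/funext => j; rewrite (re_coordE j x0) rmorphM.
split=> xy i; have := xy i; rewrite fE (re_coordE i y0);
  [by move/has_sum_realP|by move=> ?; apply/has_sum_realP].
Qed.

Lemma is_image_nonneg A x y : (forall i j, 0 <= A i j) -> nonneg x ->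
  is_image A x y -> nonneg y.
Proof.
move=> A0 x0 xy i; have := xy i.
rewrite (_ : (fun j => _) = (fun j => (A i j * re_coord x j)%:C : R[i]^o)).
  move=> /has_sum_real[-> Axy]; rewrite ler0c; apply: has_sum_ge0 Axy => j.
  by rewrite mulr_ge0 ?re_coord_ge0.
by apply/funext => j; rewrite (re_coordE j x0) rmorphM.
Qed.

(** Speaks of any [T] rather than of [mxop], so that composites can be matched directly with matrix
    products. *)
Definition kernel_op A T : Prop := forall x, is_image A x (T x).

Lemma mxop_kernel A : defines_operator L A -> kernel_op A (mxop L A).
Proof. by move=> LA x; have [y xy] := LA x; exact: (@xgetI _ _ _ y). Qed.

Lemma kernel_op_linear A T : kernel_op A T -> linear T.
Proof.
move=> AT a x y; apply: is_image_unique (AT _) _; exact: is_image_lin.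
Qed.

Lemma kernel_op_mxop A T : kernel_op A T -> mxop L A = T.
Proof.
move=> AT; apply/funext => x; apply: is_image_unique (AT x).
by apply: mxop_kernel => y; exists (T y).
Qed.

Lemma kernel_op_nonneg A T : (forall i j, 0 <= A i j) -> kernel_op A T ->
  preserves nonneg T.
Proof. by move=> A0 AT x x0; exact: is_image_nonneg (AT x). Qed.

Lemma kernel_op_entry A T i j : kernel_op A T -> seq_of L (T (unit_vector j)) i = (A i j)%:C.
Proof.
move=> /(_ (unit_vector j) i) h; apply: has_sum_unique h _.
have := has_sum_delta j (fun k => (A i k)%:C : R[i]^o).
congr has_sum; apply/funext => k.
by rewrite unit_vectorE eq_sym [RHS]mulrC.
Qed.

(** The entry is a coordinate of the image of a unit vector, and both the coordinate and the unit
    vector are controlled with constant 1. *)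
Lemma kernel_op_entry_le A T (M : R) i j : kernel_op A T -> opbound T M ->
  A i j <= M.
Proof.
move=> AT TM; have := le_trans (coord_le_rnorm _ i) (TM (unit_vector j)).
rewrite (kernel_op_entry _ _ AT) normcC rnorm_unit_vector mulr1.
exact/le_trans/ler_norm.
Qed.

Lemma kernel_op_id : kernel_op (@idmat R r) id.
Proof.
move=> x i; have := has_sum_delta i (seq_of L x : I -> R[i]^o).
congr has_sum; apply/funext => j.
by rewrite /idmat; case: (i == j).
Qed.

Section Product.
Variables (A B : I -> I -> R) (S T : L -> L).
Hypotheses (A0 : forall i j, 0 <= A i j) (B0 : forall i j, 0 <= B i j).
Hypotheses (AS : kernel_op A S) (BT : kernel_op B T).

(** The series is the coordinate [i] of [S (T e_j)], hence converges: the default value of [sum_of]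
    does not occur here. *)
Lemma mulmat_has_sum i j : has_sum (fun k => A i k * B k j) (mulmat A B i j).
Proof.
have T0 : nonneg (T (unit_vector j)).
  exact: kernel_op_nonneg B0 BT _ (nonneg_unit_vector j).
have S0 : nonneg (S (T (unit_vector j))) by exact: kernel_op_nonneg A0 AS _ T0.
have /(is_image_nonnegP _ T0 S0)/(_ i) := AS (T (unit_vector j)).
rewrite (_ : (fun k => _) = (fun k => A i k * B k j)).
  by move=> h; rewrite /mulmat (sum_ofE h).
by apply/funext => k; rewrite /re_coord (kernel_op_entry _ _ BT).
Qed.

Lemma mulmat_ge0 i j : 0 <= mulmat A B i j.
Proof. by apply: has_sum_ge0 (mulmat_has_sum i j) => k; rewrite mulr_ge0. Qed.

(** On nonnegative vectors the two orders of summation agree by [has_sum_tonelli]; linearity does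
    the rest. *)
Lemma kernel_op_mul : kernel_op (mulmat A B) (S \o T).
Proof.
have lST : linear (S \o T).
  by apply: linear_comp; exact: kernel_op_linear; eassumption.
apply: nonneg_ind => [x x0|a x y Ax Ay]; last first.
  by rewrite lST; exact: is_image_lin.
have T0 : nonneg (T x) by exact: kernel_op_nonneg B0 BT _ x0.
have S0 : nonneg (S (T x)) by exact: kernel_op_nonneg A0 AS _ T0.
apply/(is_image_nonnegP _ x0 S0) => i.
have /(is_image_nonnegP _ x0 T0) Bx := BT x.
have /(is_image_nonnegP _ T0 S0)/(_ i) Ax := AS (T x).
apply: (has_sum_tonelli (f := fun k j => A i k * (B k j * re_coord x j))) Ax _.
- by move=> k j; rewrite !mulr_ge0 // re_coord_ge0.
- by move=> k; exact: has_sumZ.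
- move=> j; have := has_sumZ (re_coord x j) (mulmat_has_sum i j).
  rewrite mulrC; congr has_sum; apply/funext => k; ring.
Qed.

End Product.

Lemma dominated_operator A B (C : R) : (forall i j, 0 <= B i j <= C * A i j) ->
  (forall i j, 0 <= A i j) -> 0 <= C ->
  defines_operator L A -> defines_operator L B.
Proof.
move=> BA A0 C0 /mxop_kernel AT.
apply: nonneg_ind => [x x0|a x x' [y xy] [y' xy']]; last first.
  by exists (a *: y + y'); exact: is_image_lin.
have y0 := kernel_op_nonneg A0 AT x0; set y := mxop L A x in y0.
have /(is_image_nonnegP _ x0 y0) Axy := AT x.
have BAx i j : 0 <= B i j * re_coord x j <= C * (A i j * re_coord x j).
  have /andP[B0 BC] := BA i j.
  by rewrite mulr_ge0 ?re_coord_ge0 //= mulrA ler_wpM2r ?re_coord_ge0.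
have /choice[z Bz] i : exists s, has_sum (fun j => B i j * re_coord x j) s.
  exact: has_sum_dominated (BAx i) (has_sumZ C (Axy i)).
have z0 i : 0 <= z i.
  by apply: has_sum_ge0 (Bz i) => j; case/andP: (BAx i j).
have zy i : z i <= C * re_coord y i.
  by apply: has_sum_le (Bz i) (has_sumZ C (Axy i)) => j; case/andP: (BAx i j).
(* The ideal property, applied below [C y], turns the coordinatewise sums into a vector of [L]. *)
have [|w wz _] := @ideal_vector (fun i => (z i)%:C) (C%:C *: y).
  move=> i; rewrite seq_ofZ (re_coordE i y0) ComplexField.Normc.normcM !normcC.
  by rewrite !ger0_norm ?mulr_ge0 ?re_coord_ge0.
exists w; have w0 : nonneg w by move=> i; rewrite wz ler0c.
by apply/(is_image_nonnegP _ x0 w0) => i; rewrite /re_coord wz.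
Qed.

Lemma dominated_opbound A B S T (C M : R) : (forall i j, 0 <= B i j <= C * A i j) ->
  (forall i j, 0 <= A i j) -> 0 <= C -> 0 <= M ->
  kernel_op A S -> kernel_op B T -> opbound S M -> opbound T (4 * (C * M)).
Proof.
move=> BA A0 C0 M0 AS BT SM.
have B0 i j : 0 <= B i j by case/andP: (BA i j).
apply: (cone_opbound nonneg_banach_cone); last by rewrite mulr_ge0.
  exact: kernel_op_linear BT.
move=> x x0.
have S0 := kernel_op_nonneg A0 AS x0; have T0 := kernel_op_nonneg B0 BT x0.
have /(is_image_nonnegP _ x0 S0) Ax := AS x.
have /(is_image_nonnegP _ x0 T0) Bx := BT x.
apply: (@le_trans _ _ (rnorm (C%:C *: S x))).
  apply: rnorm_le_coord => i.
  rewrite seq_ofZ (re_coordE i T0) (re_coordE i S0) ComplexField.Normc.normcM !normcC.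
  rewrite !ger0_norm ?mulr_ge0 ?re_coord_ge0 //.
  apply: has_sum_le (Bx i) (has_sumZ C (Ax i)) => j.
  by rewrite mulrA ler_wpM2r ?re_coord_ge0 //; case/andP: (BA i j).
by rewrite rnormZ normcC ger0_norm // -mulrA ler_wpM2l.
Qed.

End SequenceSpace.

(** * Cyclic products and the Hadamard product *)

(** Fills in the exponents between multiples of [m]. The power of [s] lags one round behind because
    the cyclic products lose a round at their ends. *)
Lemma opbound_iter_subseq (R : realType) (X : completeNormedModType R[i])
    (T : X -> X) (m : nat) (M K s : R) : (0 < m)%N -> 0 < s -> 0 <= M -> 0 <= K ->
  opbound T M -> (forall n, opbound (iter (m * n.+1) T) (K * s ^+ (m * n))) ->
  exists C, forall n, opbound (iter n T) (C * s ^+ n).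
Proof.
move=> m0 s0 M0 K0 TM Tm.
(* [b ^+ m] bounds the first [m] powers of [T]. Whether or not [s < 1], both [w >= 1] and
   [w * s >= 1], so [w ^+ (m + m)] compensates for up to [m + m] extra factors [s]. *)
pose b := 1 + M; pose w := 1 + s^-1.
have b1 : 1 <= b by rewrite lerDl.
have w1 : 1 <= w by rewrite lerDl invr_ge0 ltW.
have w0 : 0 <= w := le_trans ler01 w1.
have b0 : 0 <= b := le_trans ler01 b1.
have ws1 : 1 <= w * s by rewrite mulrDl mul1r mulVf ?lt0r_neq0 // lerDr ltW.
have Tb k : (k <= m)%N -> opbound (iter k T) (b ^+ m).
  move=> km; apply: (@opbound_le _ _ _ (b ^+ k)); last exact: ler_weXn2l.
  by apply: opbound_iter => //; apply: opbound_le TM _; rewrite lerDr.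
have sw k n : (k <= m + m)%N -> s ^+ n <= s ^+ (n + k) * w ^+ (m + m).
  move=> km; rewrite exprD -mulrA ler_peMr ?exprn_ge0 ?(ltW s0) //.
  apply: (@le_trans _ _ (s ^+ k * w ^+ k)).
    by rewrite -exprMn mulrC exprn_ege1.
  by rewrite ler_wpM2l ?exprn_ge0 ?(ltW s0) // ler_weXn2l.
exists (b ^+ m * (1 + K) * w ^+ (m + m)) => N.
have dm : (N %% m <= m)%N by rewrite ltnW // ltn_pmod.
have NE := divn_eq N m.
case: (N %/ m)%N NE => [|q] NE.
  rewrite mul0n add0n in NE; rewrite -NE in dm.
  apply: opbound_le (Tb N dm) _; rewrite -!mulrA ler_peMr ?exprn_ge0 //.
  have := sw N 0%N (leq_trans dm (leq_addr _ _)); rewrite expr0 add0n mulrC => le1.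
  by apply: (le_trans le1); rewrite ler_peMl ?lerDl // mulr_ge0 ?exprn_ge0 // ltW.
have -> : iter N T = iter (N %% m) T \o iter (m * q.+1) T.
  by apply/funext => x; rewrite /= -iterD addnC mulnC -NE.
have := opbound_comp (exprn_ge0 m b0) (Tb _ dm) (Tm q).
move=> /opbound_le; apply.
have NE' : N = (m * q + (m + N %% m))%N by rewrite {1}NE mulSn mulnC; lia.
rewrite -!mulrA ler_wpM2l ?exprn_ge0 //.
apply: ler_pM; rewrite ?exprn_ge0 ?lerDr // ?(ltW s0) //.
by rewrite [leRHS]mulrC NE'; apply: sw; rewrite leq_add2l.
Qed.

Section Paths.
Variables (R : realType) (r : index_set) (L : banachSeqSpace R r).
Hypothesis L_unit : unit_vectors_normalized L.
Local Notation I := (seq_index r).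

(** A window of [n] consecutive factors from position [c]; for a periodic [B] these windows are the
    cyclic products and their powers. *)
Fixpoint path_mat (B : nat -> I -> I -> R) (c n : nat) : I -> I -> R :=
  if n is n'.+1 then mulmat (B c) (path_mat B c.+1 n') else @idmat R r.

Fixpoint path_op (B : nat -> I -> I -> R) (c n : nat) : L -> L :=
  if n is n'.+1 then mxop L (B c) \o path_op B c.+1 n' else id.

Lemma prodmat_path (B : nat -> I -> I -> R) c n :
  prodmat (fun k : 'I_n => B (c + k)%N) = path_mat B c n.
Proof.
elim: n c => [|n IHn] c; first by rewrite /prodmat big_ord0.
rewrite /prodmat big_ord_recl addn0 /= -IHn; congr mulmat.
by apply: eq_bigr => k _; rewrite addSnnS.
Qed.

Lemma path_opD B c n p :
  path_op B c (n + p) = path_op B c n \o path_op B (c + n)%N p.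
Proof. by elim: n c => [|n IHn] c; rewrite ?addn0 //= IHn addSnnS. Qed.

Lemma path_op_const A c n : path_op (fun=> A) c n = iter n (mxop L A).
Proof. by elim: n c => [|n IHn] c //=; rewrite IHn; apply/funext. Qed.

Lemma path_op_period B m c n : (forall k, B (k + m)%N = B k) ->
  path_op B (c + m) n = path_op B c n.
Proof. by move=> Bm; elim: n c => [|n IHn] c //=; rewrite Bm -addSn IHn. Qed.

Lemma path_mat_period B m c n : (forall k, B (k + m)%N = B k) ->
  path_mat B (c + m) n = path_mat B c n.
Proof. by move=> Bm; elim: n c => [|n IHn] c //=; rewrite Bm -addSn IHn. Qed.

Section Operators.
Variable B : nat -> I -> I -> R.
Hypotheses (B0 : forall c i j, 0 <= B c i j) (LB : forall c, defines_operator L (B c)).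

(** The two claims go together because [kernel_op_mul] is applied to nonnegative factors. *)
Lemma path_mat_kernel c n :
  (forall i j, 0 <= path_mat B c n i j) /\ kernel_op (path_mat B c n) (path_op B c n).
Proof.
elim: n c => [|n IHn] c.
  by split; [move=> i j; rewrite ler0n|exact: kernel_op_id].
have [P0 PO] := IHn c.+1; split.
  exact (mulmat_ge0 L_unit (B0 c) P0 (mxop_kernel (LB c)) PO).
exact (kernel_op_mul L_unit (B0 c) P0 (mxop_kernel (LB c)) PO).
Qed.

Lemma path_op_bounded c n : bounded_operator (path_op B c n).
Proof.
have [P0 PO] := path_mat_kernel c n.
apply: (cone_bounded (nonneg_banach_cone L_unit)); first exact: kernel_op_linear PO.
exact: kernel_op_nonneg P0 PO.
Qed.

(** A window of [n + 1] rounds from [d] is an arc from [d] to the end of the round, [n] full rounds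
    from 0, and an arc of length [d]; the two arcs only affect the constant. *)
Lemma path_op_cyclic_bound m (s C : R) d : (forall k, B (k + m)%N = B k) ->
  (d <= m)%N -> 0 <= s -> 0 <= C ->
  (forall n, opbound (iter n (path_op B 0 m)) (C * s ^+ n)) ->
  exists2 D, 0 <= D & forall n, opbound (path_op B d (m * n.+1)) (D * s ^+ n).
Proof.
move=> Bm dm s0 C0 PC.
have [M1 M10 P1] := bounded_opbound (path_op_bounded d (m - d)).
have [M2 M20 P2] := bounded_opbound (path_op_bounded 0 d).
exists (M1 * (C * M2)) => [|n]; first by rewrite !mulr_ge0 // ltW.
have PnE n' : path_op B 0 (m * n') = iter n' (path_op B 0 m).
  elim: n' => [|n' IHn']; first by rewrite muln0.
  by rewrite mulnS path_opD path_op_period // IHn'; apply/funext.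
have mE : (m * n.+1 = (m - d) + (m * n + d))%N by rewrite mulnS; lia.
have sE : (d + (m - d) = 0 + m)%N by rewrite subnKC.
rewrite mE path_opD sE path_op_period // path_opD PnE add0n.
have -> : path_op B (m * n) d = path_op B 0 d.
  elim: n {mE} => [|n <-]; first by rewrite muln0.
  by rewrite mulnS addnC path_op_period.
have h := opbound_comp (mulr_ge0 C0 (exprn_ge0 n s0)) (PC n) P2.
apply: opbound_le (opbound_comp (ltW M10) P1 h) _.
by rewrite le_eqVlt; apply/orP; left; apply/eqP; ring.
Qed.

End Operators.

Section Hadamard.
Variables (m : nat) (B : nat -> I -> I -> R).
Hypotheses (B0 : forall c i j, 0 <= B c i j) (LB : forall c, defines_operator L (B c)).
Hypothesis Bm : forall k, B (k + m.+1)%N = B k.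
Let H : I -> I -> R := hadamard (fun k : 'I_m.+1 => B k).

Lemma hadamard_ge0 i j : 0 <= H i j.
Proof. exact: prodr_ge0. Qed.

(** All factors but the first have bounded entries, so [H] is dominated by a multiple of [B 0]. *)
Lemma hadamard_operator : defines_operator L H.
Proof.
have /choice[M MP] c : exists M, 0 < M /\ opbound (mxop L (B c)) M.
  (* A window of length 1 is the operator of a single matrix. *)
  have [M M0 BM] := bounded_opbound (path_op_bounded B0 LB c 1).
  by exists M.
apply: (dominated_operator L_unit _ (B0 0%N) _ (LB 0%N)
  (C := \prod_(c < m) M (lift ord0 c))).
  move=> i j; rewrite hadamard_ge0 /= /H /hadamard big_ord_recl mulrC ler_wpM2r //.
  apply: ler_prod => c _; rewrite B0 /=.
  have [_ BM] := MP (lift ord0 c).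
  exact (kernel_op_entry_le L_unit _ _ (mxop_kernel (LB _)) BM).
by apply: prodr_ge0 => c _; case: (MP (lift ord0 c)) => /ltW.
Qed.

Lemma prod_path_shift n i j :
  \prod_(d < m.+1) path_mat B d.+1 n i j = \prod_(d < m.+1) path_mat B d n i j.
Proof.
rewrite big_ord_recr [RHS]big_ord_recl mulrC /=.
by rewrite -(add0n m.+1) path_mat_period.
Qed.

(* Each term of the entry of [H ^ n] is a product over a path from [i] to [j] of
   the entries of all the [B d]; read along the diagonals of the cyclic
   arrangement it is a product of terms of the [m + 1] path matrices. *)
Lemma hadamard_path_le c n i j :
  path_mat (fun=> H) c n i j <= \prod_(d < m.+1) path_mat B d n i j.
Proof.
elim: n c i j => [|n IHn] c i j.
  by rewrite /= /idmat; case: (i == j); [rewrite big1|exact: prodr_ge0].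
have [P0 PO] := path_mat_kernel (fun=> hadamard_ge0) (fun=> hadamard_operator) c.+1 n.
have Hsum := mulmat_has_sum L_unit hadamard_ge0 P0
  (mxop_kernel hadamard_operator) PO i j.
have Bsum (d : 'I_m.+1) : has_sum (fun k => B d i k * path_mat B d.+1 n k j)
    (path_mat B d n.+1 i j).
  have [Q0 QO] := path_mat_kernel B0 LB d.+1 n.
  exact (mulmat_has_sum L_unit (B0 d) Q0 (mxop_kernel (LB d)) QO i j).
have t0 (d : 'I_m.+1) k : 0 <= B d i k * path_mat B d.+1 n k j.
  by rewrite mulr_ge0 // (path_mat_kernel B0 LB d.+1 n).1.
(* The first steps of the [m + 1] paths assemble [H i k]; the remaining paths start one place later
   in the cycle, which [prod_path_shift] undoes. *)
have prodE k : \prod_(d < m.+1) (B d i k * path_mat B d.+1 n k j) =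
    H i k * \prod_(d < m.+1) path_mat B d n k j.
  by rewrite big_split prod_path_shift.
have [v Tv] : exists v, has_sum (fun k =>
    \prod_(d < m.+1) (B d i k * path_mat B d.+1 n k j)) v.
  apply: has_sum_dominated (has_sumZ
    (\prod_(d < m) path_mat B (lift ord0 d) n.+1 i j) (Bsum ord0)) => k.
  rewrite prodr_ge0 //= big_ord_recl mulrC ler_wpM2r //.
  by apply: ler_prod => d _; rewrite t0 (has_sum_ge1 k (t0 _) (Bsum _)).
apply: le_trans (has_sum_prod t0 Bsum Tv).
apply: has_sum_le Hsum Tv => k; rewrite prodE ler_wpM2l ?hadamard_ge0 //.
Qed.

(** The window from [d = 0] is kept as an operator, while the others enter through bounds on their
    entries; each of the [m + 1] windows contributes a factor [s ^+ n]. *)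
Lemma hadamard_powers (s : R) : spectral_radius (path_op B 0 m.+1) < s ->
  exists C, forall n, opbound (iter n (mxop L H)) (C * s ^+ n).
Proof.
move=> rs; have s0 : 0 < s by apply: le_lt_trans rs; exact: spectral_radius_ge0.
have [P0 PO] := path_mat_kernel B0 LB 0 m.+1.
have [C C0 PC] := spectral_radius_powers (nonneg_banach_cone L_unit)
  (kernel_op_linear PO) (kernel_op_nonneg P0 PO) rs.
have /choice[D DP] (d : 'I_m.+1) : exists D, 0 <= D /\
    forall n, opbound (path_op B d (m.+1 * n.+1)) (D * s ^+ n).
  have [D D0 PD] := path_op_cyclic_bound B0 LB Bm (ltnW (ltn_ord d)) (ltW s0) C0 PC.
  by exists D.
have Hk := path_mat_kernel (fun=> hadamard_ge0) (fun=> hadamard_operator) 0.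
have [M M0 HM] := bounded_opbound
  (path_op_bounded (fun=> hadamard_ge0) (fun=> hadamard_operator) 0 1).
apply: (@opbound_iter_subseq _ _ _ m.+1 M (4 * \prod_d D d)) => //.
- exact: ltW.
- by rewrite mulr_ge0 // prodr_ge0 // => d _; case: (DP d).
move=> n; rewrite -(path_op_const _ 0).
have Ds0 d : 0 <= D d * s ^+ n.
  by rewrite mulr_ge0 ?exprn_ge0 ?(ltW s0) //; case: (DP d).
have [H0 HO] := Hk (m.+1 * n.+1)%N.
have [Q0 QO] := path_mat_kernel B0 LB 0 (m.+1 * n.+1).
have -> : 4 * \prod_d D d * s ^+ (m.+1 * n) =
    4 * (\prod_(d < m) (D (lift ord0 d) * s ^+ n) * (D ord0 * s ^+ n)).
  have : \prod_(d < m.+1) (D d * s ^+ n) = \prod_d D d * s ^+ (m.+1 * n).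
    by rewrite big_split /= prodr_const card_ord -exprM mulnC.
  by rewrite big_ord_recl mulrC => ->; rewrite mulrA.
have [_ /(_ n) P0D] := DP ord0.
apply: (dominated_opbound L_unit _ Q0 _ (Ds0 ord0) QO HO P0D); last first.
  by apply: prodr_ge0 => d _; exact: Ds0.
move=> i j; rewrite H0 andTb; apply: le_trans (hadamard_path_le _ _ _ _) _.
rewrite big_ord_recl mulrC ler_wpM2r //; apply: ler_prod => d _.
have [R0 RO] := path_mat_kernel B0 LB (lift ord0 d) (m.+1 * n.+1).
rewrite R0 andTb; have [_ /(_ n)] := DP (lift ord0 d).
move=> RD; exact (kernel_op_entry_le L_unit _ _ RO RD).
Qed.

Lemma hadamard_spectrum mu : spectrum (mxop L H) mu ->
  normc mu <= spectral_radius (path_op B 0 m.+1).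
Proof.
move=> Hmu; apply/ler_addgt0Pr => e e0.
set s := _ + e; have rs : spectral_radius (path_op B 0 m.+1) < s by rewrite ltrDl.
have [C HC] := hadamard_powers rs.
have [Hl Hc] := path_op_bounded (fun=> hadamard_ge0) (fun=> hadamard_operator) 0 1.
have [M M0 HM] := bounded_opbound (conj Hl Hc).
apply: spectrum_powers Hl HM _ HC Hmu.
by apply: addr_ge0; [exact: spectral_radius_ge0|exact: ltW].
Qed.

End Hadamard.
End Paths.

(** * Spectral mapping for the resolvent *)

Section Resolvent.
Variables (R : realType) (X : completeNormedModType R[i]) (T S : X -> X) (la : R[i]).
Hypotheses (Tb : bounded_operator T) (S_inv : is_inverse (scalar_minus la T) S).

(** By [la - mu^-1 - T = mu^-1 (mu - S) (la - T)], an inverse [V] of [mu - S] yields the inverse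
    [mu S V]. *)
Lemma resolvent_spectrum mu : mu != 0 ->
  spectrum T (la - mu^-1) -> spectrum S mu.
Proof.
move=> mu0 Tmu [V [[Vl Vc] SV VS]]; apply: Tmu; exists (fun x => mu *: S (V x)).
have [[Sl Sc] TS ST] := S_inv.
have shiftE y : scalar_minus (la - mu^-1) T y = scalar_minus la T y - mu^-1 *: y.
  by rewrite /scalar_minus scalerBl addrAC.
have [MV MV0 VM] := bounded_opbound (conj Vl Vc).
have [MS MS0 SM] := bounded_opbound (conj Sl Sc).
split.
- apply: (@opbound_bounded _ _ _ (normc mu * (MS * MV))).
    by move=> a x y; rewrite Vl Sl scalerDr !scalerA mulrC.
  move=> x; rewrite rnormZ -mulrA ler_wpM2l ?normc_ge0 //.
  exact: (opbound_comp (ltW MS0) SM VM).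
- move=> y; rewrite shiftE.
  have -> : scalar_minus la T y - mu^-1 *: y =
      mu^-1 *: scalar_minus mu S (scalar_minus la T y).
    rewrite [X in _ = _ *: X]/scalar_minus -/(scalar_minus la T y) TS.
    by rewrite scalerBr scalerK.
  by rewrite (linear_Z _ Vl) SV (linear_Z _ Sl) TS scalerKV.
- move=> x; rewrite shiftE scalerK //.
  by rewrite (linear_Z _ (scalar_minus_linear la Tb.1)) ST -[RHS]VS.
Qed.

(** The value 0 is excluded because [S] has the bounded inverse [la - T]. Otherwise an inverse [V]
    of [la - mu^-1 - T] yields the inverse [mu^-1 (la - T) V] of [mu - S]. *)
Lemma spectrum_resolvent mu : spectrum S mu ->
  mu != 0 /\ spectrum T (la - mu^-1).
Proof.
have [[Sl Sc] TS ST] := S_inv; have [MT MT0 TM] := bounded_opbound Tb.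
have Fl := scalar_minus_linear la Tb.1.
have FM : opbound (scalar_minus la T) (normc la + MT).
  move=> x; apply: le_trans (rnormB _ _) _; rewrite rnormZ mulrDl.
  by rewrite lerD2l.
move=> Smu; have mu0 : mu != 0.
  apply/eqP => mu0.
  have S_opp x : scalar_minus mu S x = - S x.
    by rewrite mu0 /scalar_minus scale0r sub0r.
  apply: Smu; exists (fun x => - scalar_minus la T x); split.
  - apply: (@opbound_bounded _ _ _ (normc la + MT)).
      by move=> a x y; rewrite Fl opprD scalerN.
    by move=> x; rewrite rnormN; exact: FM.
  - move=> x; rewrite S_opp -[- S x]scaleN1r (linear_Z _ Fl) ST.
    by rewrite scaleN1r opprK.
  - move=> x; rewrite S_opp -[- scalar_minus la T x]scaleN1r (linear_Z _ Sl) TS.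
    by rewrite scaleN1r opprK.
split=> //; move=> [V [[Vl Vc] TV VT]]; apply: Smu.
have shiftE y : scalar_minus (la - mu^-1) T y = scalar_minus la T y - mu^-1 *: y.
  by rewrite /scalar_minus scalerBl addrAC.
have [MV MV0 VM] := bounded_opbound (conj Vl Vc).
exists (fun x => mu^-1 *: scalar_minus la T (V x)); split.
- apply: (@opbound_bounded _ _ _ (normc mu^-1 * ((normc la + MT) * MV))).
    by move=> a x y; rewrite Vl Fl scalerDr !scalerA mulrC.
  move=> x; rewrite rnormZ -mulrA ler_wpM2l ?normc_ge0 //.
  by apply: (opbound_comp _ FM VM); rewrite addr_ge0 ?normc_ge0 // ltW.
- move=> y; have -> : scalar_minus mu S y = mu *: scalar_minus (la - mu^-1) T (S y).
    by rewrite shiftE ST scalerBr scalerKV.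
  by rewrite (linear_Z _ Vl) TV (linear_Z _ Fl) ST scalerK.
- move=> x; rewrite {1}/scalar_minus scalerKV // (linear_Z _ Sl) TS -shiftE.
  exact: VT.
Qed.

End Resolvent.

(** * Comparison of the Hadamard product with the ordinary product *)

Lemma hadamard_cyclic (R : realType) (r : index_set) (L : banachSeqSpace R r)
    (L_unit : unit_vectors_normalized L)
    (m : nat) (A : 'I_m.+1 -> seq_index r -> seq_index r -> R)
    (A_ge0 : forall k i j, 0 <= A k i j)
    (A_op : forall k, defines_operator L (A k)) :
  [/\ bounded_operator (mxop L (hadamard A)),
      kernel_op (prodmat A) (mxop L (prodmat A)) /\
      (forall i j, 0 <= prodmat A i j)
    & forall mu, spectrum (mxop L (hadamard A)) mu ->
      normc mu <= spectral_radius (mxop L (prodmat A))].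
Proof.
(* The family is continued periodically, so that cyclic products become windows of one sequence. *)
pose B (c : nat) := A (inord (c %% m.+1)).
have B0 c i j : 0 <= B c i j by exact: A_ge0.
have LB c : defines_operator L (B c) by exact: A_op.
have Bm k : B (k + m.+1)%N = B k by rewrite /B modnDr.
have BA : (fun k : 'I_m.+1 => B k) = A.
  by apply/funext => k; rewrite /B modn_small ?inord_val.
have [P0 PO] := path_mat_kernel L_unit B0 LB 0 m.+1.
have PE : prodmat A = path_mat B 0 m.+1.
  by rewrite -prodmat_path; congr prodmat; rewrite -[LHS]BA.
have H0 := @hadamard_ge0 R r m B B0; have HL := @hadamard_operator R r L L_unit m B B0 LB.
have Hspec := hadamard_spectrum L_unit B0 LB Bm.
rewrite BA in H0 HL Hspec.
rewrite PE (kernel_op_mxop PO); split=> //.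
exact: (path_op_bounded L_unit (fun=> H0) (fun=> HL) 0 1).
Qed.

Theorem corollary3p16 (R : realType) (r : index_set) (L : banachSeqSpace R r)
    (L_unit : unit_vectors_normalized L)
    (m : nat) (m_gt0 : (0 < m)%N) (A : 'I_m -> seq_index r -> seq_index r -> R)
    (A_ge0 : forall k i j, 0 <= A k i j)
    (A_op : forall k, defines_operator L (A k))
    (lambda : R)
    (lambda_gt : spectral_radius (mxop L (prodmat A)) < lambda) :
  [/\ invertible_op (scalar_minus lambda%:C (mxop L (hadamard A))),
      invertible_op (scalar_minus lambda%:C (mxop L (prodmat A)))
    & spectral_radius (op_inverse (scalar_minus lambda%:C (mxop L (hadamard A))))
      <= spectral_radius (op_inverse (scalar_minus lambda%:C (mxop L (prodmat A))))].
Proof.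
case: m m_gt0 A A_ge0 A_op lambda_gt => [//|m] _ A A_ge0 A_op lambda_gt.
have [Hb [PO P0] Hspec] := hadamard_cyclic L_unit A_ge0 A_op.
set P := mxop L (prodmat A) in PO lambda_gt Hspec *.
set H := mxop L (hadamard A) in Hb Hspec *.
have Pcone : preserves (nonneg (L := L)) P by exact: kernel_op_nonneg P0 PO.
have Pl : linear P by exact: kernel_op_linear PO.
have Pb : bounded_operator P := cone_bounded (nonneg_banach_cone L_unit) Pl Pcone.
set rho := spectral_radius P in lambda_gt Hspec *.
have rho0 : 0 <= rho := spectral_radius_ge0 P.
have lambda0 : 0 < lambda := le_lt_trans rho0 lambda_gt.
have [SH SH_inv] : invertible_op (scalar_minus lambda%:C H).
  apply: not_spectrum => /Hspec; rewrite normcC gtr0_norm //.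
  by rewrite leNgt lambda_gt.
have [SP SP_inv] : invertible_op (scalar_minus lambda%:C P).
  apply: not_spectrum => /(le_spectral_radius Pb); rewrite normcC gtr0_norm //.
  by rewrite leNgt lambda_gt.
split; [by exists SH|by exists SP|].
rewrite (op_inverseE SH_inv) (op_inverseE SP_inv).
have dpos : 0 < lambda - rho by rewrite subr_gt0.
have rhoP : spectrum P rho%:C.
  (* Every index set is non-empty, so [L] contains a unit vector and is not the zero space. *)
  have i : seq_index r by case: (r) => [k|]; [exact: ord0|exact: 0%N].
  apply: (spectral_radius_spectrum (nonneg_banach_cone L_unit)
    (x := unit_vector L_unit i)) => //.
  apply/eqP => e0; have := rnorm_unit_vector L_unit i.
  by rewrite e0 rnorm0 => /esym/eqP; rewrite oner_eq0.
have SP_ge : (lambda - rho)^-1 <= spectral_radius SP.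
  have SPb : bounded_operator SP by case: SP_inv.
  (* The value [mu = 1 / (lambda - rho)] solves [lambda - mu^-1 = rho]. *)
  suff /(le_spectral_radius SPb) : spectrum SP ((lambda - rho)^-1)%:C.
    by rewrite normcC gtr0_norm // invr_gt0.
  apply: (resolvent_spectrum Pb SP_inv).
    by apply/eqP => -[] /eqP; rewrite invr_eq0 gt_eqF.
  by rewrite -fmorphV invrK -rmorphB subKr.
apply: le_trans SP_ge; apply: spectral_radius_le => [|mu].
  by rewrite invr_ge0 ltW.
move=> /(spectrum_resolvent Hb SH_inv)[mu0 /Hspec le_rho].
have mu_gt0 : 0 < normc mu.
  rewrite lt_neqAle normc_ge0 andbT eq_sym; apply: contra mu0 => /eqP.
  by move=> /ComplexField.Normc.eq0_normc ->.
rewrite -[leLHS]invrK lef_pV2 ?posrE ?invr_gt0 // -normcV lerBlDr.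
(* Here [lambda <= |mu^-1| + |lambda - mu^-1|], and the last term is at most [rho] because
   [lambda - mu^-1] is in the spectrum of [H]. *)
have := le_normcD (mu^-1) (lambda%:C - mu^-1).
rewrite addrC subrK normcC gtr0_norm // => /le_trans; apply.
by rewrite lerD2l.
Qed.
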